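(* For every $\mathfrak C$-coloured unital symmetric operad $P$ and every $\mathfrak D$-coloured unital symmetric operad $Q$ (in $\mathrm{Set}$), there is an isomorphism of coloured operads $$P\otimes_{BV}Q\;\cong\;\mathbb A(\mathbb I P\wr\mathbb I Q),$$ where $\otimes_{BV}$ is the Boardman–Vogt tensor product, $\wr$ is the wreath product of operadic categories, $\mathbb I$ is the operadic Grothendieck construction and $\mathbb A:\mathsf{OpCat}\to\mathsf{SOp}$ is its left adjoint.
   Context: **Fin.** $\mathrm{Fin}$ is the category with objects $\underline n=\{1<\dots<n\}$, $n\ge 0$, and all maps of sets. For $f:\underline n\to\underline m$ and $i\in\underline m$, the fiber $f^{-1}(i)$ is the object of $\mathrm{Fin}$ order-isomorphic to the preimage of $i$; its elements are identified with those of the preimage by the order-preserving bijection. For $f:T\to S$, $g:S\to R$, $h=gf$ and $i\in R$, restriction gives $f_i:h^{-1}(i)\to g^{-1}(i)$. **Operadic categories** (always strict). An operadic category is a category $O$ (with a small set $\pi_0(O)$ of connected components) with a cardinality functor $|-|:O\to\mathrm{Fin}$, a chosen terminal object $U_c$ of each connected component $c\in\pi_0(O)$ (the chosen local terminal objects), and, for every $f:T\to S$ and $i\in|S|$, an object $f^{-1}(i)$ (the $i$-th fiber) with $|f^{-1}(i)|=|f|^{-1}(i)$, such that: (AX1) $|U_c|=\underline 1$ for all $c$. (AX2) All fibers of every identity morphism are chosen local terminal objects. (AX3) For $f:T\to S$, $g:S\to R$, $h=gf$ and $i\in|R|$ there is a given morphism $f_i:h^{-1}(i)\to g^{-1}(i)$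 whose cardinality is the map $|f|_i$ induced in $\mathrm{Fin}$, and this gives a functor $\mathrm{Fib}_i:O/R\to O$, $g\mapsto g^{-1}(i)$. (AX3a) For $R=U_c$, $\mathrm{Fib}_1:O/U_c\to O$ is the domain functor. (AX4) In the situation of (AX3), for $j\in|S|$ and $i=|g|(j)$, one has $f_i^{-1}(j)=f^{-1}(j)$. (AX5) For $f:T\to S$, $a:S\to Q$, $b=af$, $c:Q\to R$, $g=ca$, $h=cb$, and $j\in|Q|$, $i=|c|(j)$: the morphism $(f_i)_j:b_i^{-1}(j)\to a_i^{-1}(j)$ induced by $f_i:h^{-1}(i)\to g^{-1}(i)$ over $c^{-1}(i)$ equals $f_j:b^{-1}(j)\to a^{-1}(j)$. An operadic functor is a functor commuting with cardinalities and preserving fibers, chosen local terminal objects and the induced morphisms. $\mathsf{OpCat}$ is the category of operadic categories and operadic functors. **Bouquets and arity.** For a set $\mathfrak C$, $\mathsf{Bq}(\mathfrak C)$ is the operadic category whose objects are bouquets $(c_1,\dots,c_k;c)$ with $k\ge0$ and entries in $\mathfrak C$ ($c$ is the root colour), whose morphisms $(c_1,\dots,c_k;c)\to(c'_1,\dots,c'_l;c)$ are all maps $\underline k\to\underline l$ (none if root colours differ), with cardinality $\underline k$; the fiber of $f$ over $y\in\underline l$ has underlying set $f^{-1}(y)$ with inherited colours and root colour $c'_y$. Its components are indexed by $\mathfrak C$, with chosen local terminal objects $(c;c)$. For an operadic category $O$, the arity functor $Ar_O:O\to\mathsf{Bq}(\pi_0(O))$ is the operadic functor $T\mapsto(c_1,\dots,c_k;\pi_0(T))$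 where $k=|T|$ and $\mathrm{id}_T^{-1}(i)=U_{c_i}$; on morphisms it is the cardinality. **Operads.** For an operadic category $O$, an $O$-operad (in $\mathrm{Set}$) is a family of sets $P=\{P(T)\}_{T\in O}$ with units $u_c\in P(U_c)$, $c\in\pi_0(O)$, and structure maps $\mu_P^f:\prod_{i\in|S|}P(f^{-1}(i))\times P(S)\to P(T)$ for $f:T\to S$, such that: (associativity) for $f:T\to S$, $g:S\to R$, $h=gf$, $x_j\in P(f^{-1}(j))$, $y_i\in P(g^{-1}(i))$, $z\in P(R)$: $\mu^f\big((x_j)_j,\mu^g((y_i)_i,z)\big)=\mu^h\big((\mu^{f_i}((x_j)_{j\in|g|^{-1}(i)},y_i))_i,z\big)$; (units) $\mu^{\mathrm{id}_T}((u)_i,x)=x$ and $\mu^{!_T}(x,u_c)=x$ for $x\in P(T)$, $!_T:T\to U_c$ the unique morphism. Morphisms of $O$-operads are families of maps commuting with the structure maps and units; they form the category $\mathsf{Op}^{O}$. An operadic functor $F:O\to R$ induces restriction $F^*:\mathsf{Op}^R\to\mathsf{Op}^O$, $F^*(Q)(T)=Q(F(T))$, $\mu^f_{F^*Q}=\mu_Q^{F(f)}$. Operads over $\mathsf{Bq}(\mathfrak C)$ are identified with symmetric unital $\mathfrak C$-coloured operads in $\mathrm{Set}$: $\gamma(x;x_1,\dots,x_n)=\mu^\nu((x_1,\dots,x_n),x)$ with $\nu$ the order-preserving map sending the inputs of $x_i$ to $i$, and $x\cdot\pi=\mu^\pi((u,\dots,u),x)$ for a permutation $\pi$. **$\mathsf{SOp}$.**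 Objects are pairs $(\mathfrak C,P)$ with $\mathfrak C$ a set and $P\in\mathsf{Op}^{\mathsf{Bq}(\mathfrak C)}$; morphisms $(\mathfrak C,P)\to(\mathfrak D,Q)$ are pairs of an operadic functor $F:\mathsf{Bq}(\mathfrak C)\to\mathsf{Bq}(\mathfrak D)$ (equivalently, a map $\mathfrak C\to\mathfrak D$) and a morphism $P\to F^*(Q)$ in $\mathsf{Op}^{\mathsf{Bq}(\mathfrak C)}$. **The functor $\mathbb I$.** For an $O$-operad $P$, the operadic Grothendieck construction $\int_O P$ is the category whose objects are elements $t\in P(T)$, $T\in O$; a morphism from $t\in P(T)$ to $s\in P(S)$ is a pair $(\varepsilon,f)$ with $f:T\to S$ in $O$ and $\varepsilon\in\prod_{i\in|S|}P(f^{-1}(i))$ such that $\mu_P^f(\varepsilon,s)=t$. It is an operadic category: the cardinality of $t\in P(T)$ is $|T|$, the $i$-th fiber of $(\varepsilon,f)$ is $\varepsilon_i$, the chosen local terminal objects are the units $u_c$, composition is $(\delta,g)(\varepsilon,f)=(\kappa,gf)$ with $\kappa_i=\mu^{f_i}((\varepsilon_j)_{|g|(j)=i},\delta_i)$, and the induced morphism on $i$-th fibers is $((\varepsilon_j)_{|g|(j)=i},f_i):\kappa_i\to\delta_i$. For a $\mathfrak C$-coloured operad $P$, $\mathbb I P=\int_{\mathsf{Bq}(\mathfrak C)}P$. **The functor $\mathbb A$.** For an operadic category $O$, $\mathbb A(O)\in\mathsf{Op}^{\mathsf{Bq}(\pi_0(O))}$ is the free unital symmetric $\pi_0(O)$-coloured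 operad on generators $[T]$ of arity $Ar_O(T)$, one for each object $T\in O$, modulo the operadic congruence generated by $[U_c]\sim u_c$ for all $c\in\pi_0(O)$ and $\mu^{Ar_O(f)}\big(([f^{-1}(i)])_{i\in|S|},[S]\big)\sim[T]$ for all $f:T\to S$ in $O$. An operadic functor $F$ induces $\mathbb A(F)$ over the colour map $c\mapsto\pi_0(F(U_c))$ by $[T]\mapsto[F(T)]$. **Wreath product.** For operadic categories $O,R$, the objects of $O\wr R$ are tuples $(X;Y_1,\dots,Y_n)$ with $X\in O$, $|X|=\underline n$, and $Y_1,\dots,Y_n\in R$ lying in the same connected component $d\in\pi_0(R)$; the component $d$ is part of the data (relevant only for $n=0$), and morphisms exist only between objects with the same $d$. A morphism $(\varphi,\Phi):(X;Y_1,\dots,Y_n)\to(Z;W_1,\dots,W_k)$ consists of $\varphi:X\to Z$ in $O$ and a family $\Phi=\{\varphi_{ij}:Y_i\to W_j\mid |\varphi|(i)=j\}$ of morphisms in $R$. The cardinality of $(X;Y_1,\dots,Y_n)$ is $\coprod_{i\in\underline n}|Y_i|$ (ordered sum), and that of $(\varphi,\Phi)$ is $\coprod|\varphi_{ij}|$. The fiber of $(\varphi,\Phi)$ over $i\in|W_t|$, $t\in|Z|$, is $(\varphi^{-1}(t);(\varphi_{st}^{-1}(i))_{s\in|\varphi|^{-1}(t)})$ (with component that of $\mathrm{id}_{W_t}^{-1}(i)$); induced morphisms are defined componentwise. The chosen local terminal objects are $(U;V)$ with $U$, $V$ chosen local terminal objects of $O$, $R$; thus $\pi_0(O\wr R)=\pi_0(O)\times\pi_0(R)$.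 **Boardman–Vogt tensor product.** For a symmetric $\mathfrak C$-coloured operad $P$ and a symmetric $\mathfrak D$-coloured operad $Q$, $P\otimes_{BV}Q$ is the symmetric operad with colour set $\mathfrak C\times\mathfrak D$ generated by elements $x\otimes d$ of arity $((c_1,d),\dots,(c_n,d);(c,d))$, for $x\in P(c_1,\dots,c_n;c)$ and $d\in\mathfrak D$, and $c\otimes y$ of arity $((c,d_1),\dots,(c,d_m);(c,d))$, for $c\in\mathfrak C$ and $y\in Q(d_1,\dots,d_m;d)$, subject to relations making each $-\otimes d:P\to P\otimes_{BV}Q$ and each $c\otimes-:Q\to P\otimes_{BV}Q$ a morphism of operads (compatible with composition, units and symmetric group actions), and the interchange relation: for $x\in P(c_1,\dots,c_n;c)$, $y\in Q(d_1,\dots,d_m;d)$, $$\gamma(x\otimes d;\,c_1\otimes y,\dots,c_n\otimes y)=\gamma(c\otimes y;\,x\otimes d_1,\dots,x\otimes d_m)\cdot\mathit{shuffle},$$ where $\mathit{shuffle}$ is the permutation reordering the inputs $(c_i,d_j)$ from reverse-lexicographic to lexicographic order. *)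

(* Defs.v *)
From Stdlib Require Import Relations.
From mathcomp Require Import all_boot all_order generic_quotient.
From mathcomp Require Import boolp.

Set Implicit Arguments.
Unset Strict Implicit.
Unset Printing Implicit Defensive.

(* The object n of Fin is 'I_n, so |T| is a natural number and indices start
   at 0. *)
Definition fin_fib n m (f : 'I_n -> 'I_m) (i : 'I_m) : {set 'I_n} :=
  [set x | f x == i].

(* The order-preserving identification of k with a subset of n of size k. *)
Definition fin_incl n k (A : {set 'I_n}) (e : k = #|A|) (x : 'I_k) : 'I_n :=
  enum_val (cast_ord e x).

Lemma fin_inclP n k (A : {set 'I_n}) (e : k = #|A|) x : fin_incl e x \in A.
Proof. exact: enum_valP. Qed.

Lemma fin_fibP n m (f : 'I_n -> 'I_m) i k (e : k = #|fin_fib f i|) x :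
  f (fin_incl e x) = i.
Proof. by have := fin_inclP e x; rewrite inE => /eqP. Qed.

Lemma fin_incl_inj n k (A : {set 'I_n}) (e : k = #|A|) :
  injective (fin_incl e).
Proof. by move=> x y /enum_val_inj /cast_ord_inj. Qed.

Lemma fin_incl_id n (A : {set 'I_n}) (e : #|A| = #|A|) x :
  fin_incl e x = enum_val x.
Proof. by rewrite /fin_incl cast_ord_id. Qed.

Section FinInclUnique.
Variables (n k : nat) (A : {set 'I_n}) (u : 'I_k -> 'I_n).
Hypothesis u_mono : forall x y : 'I_k, x < y -> u x < u y.
Hypothesis u_img : forall x, (x \in A) <-> exists y, u y = x.

Lemma sorted_enum_set : sorted (fun x y : 'I_n => x < y) (enum A).
Proof.
rewrite {1}/enum_mem sorted_filter //; first by move=> x y z; apply: ltn_trans.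
have := iota_ltn_sorted 0 n.
rewrite -(val_enum_ord n) sorted_map enumT.
by [].
Qed.

Lemma enum_set_map : map u (enum 'I_k) = enum A.
Proof.
apply: (@irr_sorted_eq _ (fun x y : 'I_n => x < y)).
- by move=> x y z; apply: ltn_trans.
- by move=> x; apply: ltnn.
- rewrite sorted_map.
  have : sorted ltn (map val (enum 'I_k)) by rewrite val_enum_ord iota_ltn_sorted.
  rewrite sorted_map; apply: sub_sorted => x y /=; exact: u_mono.
- exact: sorted_enum_set.
move=> x; rewrite mem_enum; apply/mapP/idP.
  by case=> y _ ->; apply/u_img; exists y.
by move/u_img => [y <-]; exists y; rewrite ?mem_enum.
Qed.

Lemma fin_card_unique : k = #|A|.
Proof. by rewrite cardE -enum_set_map size_map size_enum_ord. Qed.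

Lemma fin_incl_unique (e : k = #|A|) x : fin_incl e x = u x.
Proof.
rewrite /fin_incl (enum_val_nth (u x)) -enum_set_map /=.
rewrite (nth_map x) ?size_enum_ord //; congr u.
exact: nth_ord_enum.
Qed.
End FinInclUnique.

Lemma fin_incl_mono n k (A : {set 'I_n}) (e : k = #|A|) (x y : 'I_k) :
  x < y -> fin_incl e x < fin_incl e y.
Proof.
move=> xy; rewrite /fin_incl.
set x' := cast_ord e x; set y' := cast_ord e y.
have xy' : x' < y' by [].
rewrite (enum_val_nth (fin_incl e x) x') (enum_val_nth (fin_incl e x) y').
apply: (@sorted_ltn_nth _ (fun x y : 'I_n => x < y)) => //.
- by move=> a b c; apply: ltn_trans.
- exact: sorted_enum_set.
- by rewrite inE -cardE.
- by rewrite inE -cardE.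
Qed.

(* Fibers of a restriction F' : A -> B of F : n -> m, where A contains the
   preimage of B. *)
Section FinRestrict.
Variables (n m a b : nat) (F : 'I_n -> 'I_m) (F' : 'I_a -> 'I_b).
Variables (A : {set 'I_n}) (B : {set 'I_m}) (eA : a = #|A|) (eB : b = #|B|).
Hypothesis F'E : forall x, fin_incl eB (F' x) = F (fin_incl eA x).
Hypothesis sub : forall x, F x \in B -> x \in A.
Variable j : 'I_b.

Lemma fin_incl_surj x : x \in A -> exists y, fin_incl eA y = x.
Proof.
move=> xA; exists (cast_ord (esym eA) (enum_rank_in xA x)).
by rewrite /fin_incl cast_ordKV enum_rankK_in.
Qed.

Variables (k k' : nat) (ek : k = #|fin_fib F' j|)
  (ek' : k' = #|fin_fib F (fin_incl eB j)|).

Let u (x : 'I_k) := fin_incl eA (fin_incl ek x).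

Lemma fin_restrict_mono (x y : 'I_k) : x < y -> u x < u y.
Proof. by move=> xy; do 2!apply: fin_incl_mono. Qed.

Lemma fin_restrict_img x :
  (x \in fin_fib F (fin_incl eB j)) <-> exists y, u y = x.
Proof.
split; last first.
  by case=> y <-; rewrite inE -F'E (fin_fibP ek).
rewrite inE => /eqP fx.
have /fin_incl_surj [y ey] : x \in A by apply: sub; rewrite fx fin_inclP.
have yF : y \in fin_fib F' j.
  by rewrite inE; apply/eqP; apply: (fin_incl_inj (e := eB)); rewrite F'E ey.
exists (cast_ord (esym ek) (enum_rank_in yF y)).
by rewrite /u {2}/fin_incl cast_ordKV enum_rankK_in.
Qed.

Lemma fin_restrict_card : k = k'.
Proof. by rewrite ek'; apply: fin_card_unique fin_restrict_mono fin_restrict_img. Qed.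

Lemma fin_restrict_incl (x : 'I_k) (y : 'I_k') : x = y :> nat ->
  fin_incl eA (fin_incl ek x) = fin_incl ek' y.
Proof.
move=> xy; have -> : y = cast_ord fin_restrict_card x by apply: val_inj.
have := fin_incl_unique fin_restrict_mono fin_restrict_img
  (etrans fin_restrict_card ek') x.
rewrite /u => <-; rewrite /fin_incl; congr enum_val; exact: val_inj.
Qed.
End FinRestrict.

(* An element of an indexed family together with its index. *)
Definition pk (I : Type) (P : I -> Type) (i : I) (x : P i) : {i : I & P i} :=
  existT P i x.

Definition tr (I : Type) (P : I -> Type) (i j : I) (e : i = j) (x : P i) : P j :=
  eq_rect i P x j e.

Lemma pk_inj I (P : I -> Type) i (x y : P i) : pk x = pk y -> x = y.
Proof.
rewrite /pk => e.
have [q Hq] : exists q : i = i, tr q x = y.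
  have := f_equal (@projT1 I P) e => /= q0.
  exists (f_equal (@projT1 I P) e).
  rewrite /tr.
  have gen : forall (u v : {i : I & P i}) (e : u = v),
    eq_rect (projT1 u) P (projT2 u) (projT1 v) (f_equal (@projT1 I P) e) = projT2 v.
    by move=> u v; case: _ /.
  exact: (gen _ _ e).
by rewrite -Hq (Prop_irrelevance q (erefl i)).
Qed.

Lemma pk_tr I (P : I -> Type) i j (e : i = j) (x : P i) : pk (tr e x) = pk x.
Proof. by case: _ / e. Qed.

Lemma tr_pk I (P : I -> Type) i j (e : i = j) (x : P i) (y : P j) :
  pk x = pk y -> tr e x = y.
Proof. by move=> exy; apply: pk_inj; rewrite pk_tr. Qed.

(* A morphism together with its source and target; equality of such packages
   is equality of morphisms in a strict category. *)
Definition arr (Ob : Type) (Hom : Ob -> Ob -> Type) T S (f : Hom T S) :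
  {TS : Ob * Ob & Hom TS.1 TS.2} :=
  existT (fun TS : Ob * Ob => Hom TS.1 TS.2) (T, S) f.

Lemma arr_inj (Ob : Type) (Hom : Ob -> Ob -> Type) T S (f f' : Hom T S) :
  arr f = arr f' -> f = f'.
Proof.
exact: (@pk_inj _ (fun TS : Ob * Ob => Hom TS.1 TS.2) (T, S) f f').
Qed.

(* pi0 is a set presenting the connected components: pi is the quotient map
   of Ob by connectedness, its surjectivity being witnessed by U.
   In ind the composite h = g f is passed together with an equation, so that
   the functoriality of Fib_i needs no transport.  The index j of AX4 and AX5
   ranges over |g|^-1(i), respectively |c|^-1(i), as a set of its own; fin_incl
   is the corresponding element of |S|, respectively |Q|. *)
Record OpCat := {
  Ob : Type;
  Hom : Ob -> Ob -> Type;
  idm : forall T, Hom T T;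
  cmp : forall T S R, Hom S R -> Hom T S -> Hom T R;
  cmp_idl : forall T S (f : Hom T S), cmp (idm S) f = f;
  cmp_idr : forall T S (f : Hom T S), cmp f (idm T) = f;
  cmpA : forall T S R Q (f : Hom T S) (g : Hom S R) (h : Hom R Q),
    cmp h (cmp g f) = cmp (cmp h g) f;

  pi0 : Type;
  pi : Ob -> pi0;
  piP : forall T S, pi T = pi S <->
    clos_refl_sym_trans Ob (fun T S => inhabited (Hom T S)) T S;
  U : pi0 -> Ob;
  pi_U : forall c, pi (U c) = c;
  U_terminal : forall T c, pi T = c -> exists f : Hom T (U c), forall g, g = f;

  card : Ob -> nat;
  cmap : forall T S, Hom T S -> 'I_(card T) -> 'I_(card S);
  cmap_id : forall T x, cmap (idm T) x = x;
  cmap_cmp : forall T S R (f : Hom T S) (g : Hom S R) x,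
    cmap (cmp g f) x = cmap g (cmap f x);

  fib : forall T S, Hom T S -> 'I_(card S) -> Ob;
  fib_card : forall T S (f : Hom T S) i,
    card (fib f i) = #|fin_fib (cmap f) i|;

  AX1 : forall c, card (U c) = 1;
  AX2 : forall T i, exists c, fib (idm T) i = U c;

  ind : forall T S R (f : Hom T S) (g : Hom S R) (h : Hom T R),
    h = cmp g f -> forall i, Hom (fib h i) (fib g i);
  ind_cmap : forall T S R (f : Hom T S) (g : Hom S R) (h : Hom T R)
    (e : h = cmp g f) i x,
    fin_incl (fib_card g i) (cmap (ind e i) x) =
    cmap f (fin_incl (fib_card h i) x);
  ind_id : forall S R (g : Hom S R) (e : g = cmp g (idm S)) i,
    ind e i = idm (fib g i);
  ind_cmp : forall T S Q R (f : Hom T S) (a : Hom S Q) (c : Hom Q R)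
    (b : Hom T Q) (g : Hom S R) (h : Hom T R)
    (eb : b = cmp a f) (eg : g = cmp c a) (eh : h = cmp c b)
    (eh' : h = cmp g f) i,
    ind eh i = cmp (ind eg i) (ind eh' i);

  AX3a_ob : forall T c (f : Hom T (U c)) i, fib f i = T;
  AX3a_hom : forall T S c (f : Hom T S) (g : Hom S (U c)) (h : Hom T (U c))
    (e : h = cmp g f) i, arr (ind e i) = arr f;

  AX4 : forall T S R (f : Hom T S) (g : Hom S R) (h : Hom T R)
    (e : h = cmp g f) i (j : 'I_(card (fib g i))),
    fib (ind e i) j = fib f (fin_incl (fib_card g i) j);

  AX5 : forall T S Q R (f : Hom T S) (a : Hom S Q) (c : Hom Q R)
    (b : Hom T Q) (g : Hom S R) (h : Hom T R)
    (eb : b = cmp a f) (eg : g = cmp c a) (eh : h = cmp c b)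
    (eh' : h = cmp g f) i
    (ei : ind eh i = cmp (ind eg i) (ind eh' i))
    (j : 'I_(card (fib c i))),
    arr (ind ei j) = arr (ind eb (fin_incl (fib_card c i) j))
}.
Arguments idm {o} T.
Arguments U {o} c.
Arguments pi {o} T.

Section OpCatTheory.
Variable O : OpCat.
Implicit Types T S R : Ob O.

Lemma ind_eq T S R (f : Hom T S) (g : Hom S R) (h : Hom T R)
  (e e' : h = cmp g f) i : ind e i = ind e' i.
Proof. by rewrite (Prop_irrelevance e e'). Qed.

Lemma pi_hom T S (f : Hom T S) : pi T = pi S.
Proof. by apply/piP; apply: rst_step; exists. Qed.

Lemma fib_congr T S T' S' (f : Hom T S) (f' : Hom T' S')
  (i : 'I_(card S)) (i' : 'I_(card S')) :
  arr f = arr f' -> i = i' :> nat -> fib f i = fib f' i'.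
Proof.
move=> e.
have gen : forall a b : {TS : Ob O * Ob O & Hom TS.1 TS.2}, a = b ->
  forall (i : 'I_(card (projT1 a).2)) (i' : 'I_(card (projT1 b).2)),
  i = i' :> nat -> fib (projT2 a) i = fib (projT2 b) i'.
  by move=> a b; case: _ / => j j' /val_inj ->.
exact: (gen _ _ e).
Qed.

Lemma pi_fib T S (f : Hom T S) i : pi (fib f i) = pi (fib (idm S) i).
Proof. exact: pi_hom (ind (esym (cmp_idl f)) i). Qed.

Lemma fib_id_U T i : fib (idm T) i = U (pi (fib (idm T) i)).
Proof. by case: (AX2 i) => c ->; rewrite pi_U. Qed.

Lemma U_hom_uniq T c (f g : Hom T (U c)) : f = g.
Proof.
have [k Hk] := U_terminal (etrans (pi_hom f) (pi_U c)).
by rewrite (Hk f) (Hk g).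
Qed.

Lemma pi_fib_id T S (f : Hom T S) i j :
  pi (fib (idm (fib f i)) j) = pi (fib (idm T) (fin_incl (fib_card f i) j)).
Proof.
rewrite -(AX4 (esym (cmp_idr f))); congr pi; apply: fib_congr => //.
by rewrite ind_id.
Qed.

Lemma cmap_arr T S T' S' (f : Hom T S) (f' : Hom T' S')
  (x : 'I_(card T)) (x' : 'I_(card T')) :
  arr f = arr f' -> x = x' :> nat -> cmap f x = cmap f' x' :> nat.
Proof.
move=> e.
have gen : forall a b : {TS : Ob O * Ob O & Hom TS.1 TS.2}, a = b ->
  forall (i : 'I_(card (projT1 a).1)) (i' : 'I_(card (projT1 b).1)),
  i = i' :> nat -> cmap (projT2 a) i = cmap (projT2 b) i' :> nat.
  by move=> a b; case: _ / => j j' /val_inj ->.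
exact: (gen _ _ e).
Qed.

Definition bang T c (e : pi T = c) : Hom T (U c) :=
  sval (cid (U_terminal e)).

Lemma U_ord c (i j : 'I_(card (U (o := O) c))) : i = j.
Proof.
apply: val_inj; case: i j => [i Hi] [j Hj] /=; move: Hi Hj; rewrite AX1.
by case: i j => [|i] [|j].
Qed.
End OpCatTheory.

Lemma connected_of_terminal (Ob : Type) (Hom : Ob -> Ob -> Type) (pi0 : Type)
  (pi : Ob -> pi0) (U : pi0 -> Ob) :
  (forall T S, Hom T S -> pi T = pi S) ->
  (forall T c, pi T = c -> exists f : Hom T (U c), forall g, g = f) ->
  forall T S, pi T = pi S <->
    clos_refl_sym_trans Ob (fun T S => inhabited (Hom T S)) T S.
Proof.
move=> pi_hom term T S; split.
  move=> e; have [f _] := term T _ e; have [g _] := term S _ erefl.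
  apply: (rst_trans _ _ _ (U (pi S))); first by apply: rst_step; exists.
  by apply: rst_sym; apply: rst_step; exists.
elim=> {T S} [T S [f]|//|T S _ -> //|T S R _ -> _ -> //].
exact: pi_hom f.
Qed.

Set Primitive Projections.
(* Primitive projections make the bouquets with colours changed along the
   identity, or along a composite, convertible to the expected ones. *)
Record bouquet (C : Type) := Bouquet {
  bar : nat;
  bcol : 'I_bar -> C;
  broot : C
}.
Unset Primitive Projections.
Arguments bcol {C} b.

Section Bouquets.
Variable C : Type.
Implicit Types T S R : bouquet C.

Record bqmap T S := Bqmap {
  bfun :> 'I_(bar T) -> 'I_(bar S);
  bqmap_root : broot T = broot S
}.

Lemma bqmap_eq T S (f g : bqmap T S) : bfun f =1 bfun g -> f = g.
Proof.
case: f => f ef; case: g => g eg /= /funext fg; case: _ / fg.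
by congr Bqmap; apply: Prop_irrelevance.
Qed.

Lemma bouquet_eq T S : bar T = bar S -> broot T = broot S ->
  (forall (x : 'I_(bar T)) (y : 'I_(bar S)), x = y :> nat -> bcol T x = bcol S y) ->
  T = S.
Proof.
case: T => n c r; case: S => n' c' r' /= en er; case: _ / en in c' *.
by case: _ / er => cc; congr Bouquet; apply: funext => x; apply: cc.
Qed.

Lemma bqarr_eq T S T' S' (f : bqmap T S) (f' : bqmap T' S') :
  T = T' -> S = S' ->
  (forall (x : 'I_(bar T)) (x' : 'I_(bar T')), x = x' :> nat -> f x = f' x' :> nat) ->
  arr f = arr f'.
Proof.
move=> eT eS; case: _ / eT in f' *; case: _ / eS in f' * => ff.
by congr (arr _); apply: bqmap_eq => x; apply: val_inj; apply: ff.
Qed.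

Definition bq_id T : bqmap T T := Bqmap id erefl.
Definition bq_cmp T S R (g : bqmap S R) (f : bqmap T S) : bqmap T R :=
  Bqmap (fun x => g (f x)) (etrans (bqmap_root f) (bqmap_root g)).
Definition bq_U (c : C) := @Bouquet C 1 (fun=> c) c.
Definition bq_fib T S (f : bqmap T S) (y : 'I_(bar S)) : bouquet C :=
  @Bouquet C #|fin_fib f y| (fun x => bcol T (enum_val x)) (bcol S y).

Lemma bq_ind_mem T S R (f : bqmap T S) (g : bqmap S R) (h : bqmap T R)
  (e : h = bq_cmp g f) i (x : 'I_(bar (bq_fib h i))) :
  f (enum_val x) \in fin_fib g i.
Proof.
have eh z : h z = g (f z) by rewrite e.
by have := enum_valP x; rewrite !inE eh.
Qed.

Definition bq_ind T S R (f : bqmap T S) (g : bqmap S R) (h : bqmap T R)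
  (e : h = bq_cmp g f) i : bqmap (bq_fib h i) (bq_fib g i) :=
  @Bqmap (bq_fib h i) (bq_fib g i)
    (fun x => enum_rank_in (bq_ind_mem e x) (f (enum_val x))) erefl.

Lemma bq_indE T S R (f : bqmap T S) (g : bqmap S R) (h : bqmap T R)
  (e : h = bq_cmp g f) i x : enum_val (bq_ind e i x) = f (enum_val x).
Proof. by rewrite /= enum_rankK_in // bq_ind_mem. Qed.

Lemma bq_ind_id S R (g : bqmap S R) (e : g = bq_cmp g (bq_id S)) i :
  bq_ind e i = bq_id (bq_fib g i).
Proof. by apply: bqmap_eq => x; apply: enum_val_inj; rewrite bq_indE. Qed.

Lemma bq_ind_cmp T S Q R (f : bqmap T S) (a : bqmap S Q) (c : bqmap Q R)
    (b : bqmap T Q) (g : bqmap S R) (h : bqmap T R)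
    (eb : b = bq_cmp a f) (eg : g = bq_cmp c a) (eh : h = bq_cmp c b)
    (eh' : h = bq_cmp g f) i :
    bq_ind eh i = bq_cmp (bq_ind eg i) (bq_ind eh' i).
Proof.
apply: bqmap_eq => x; apply: enum_val_inj; rewrite bq_indE.
have -> : bq_cmp (bq_ind eg i) (bq_ind eh' i) x = bq_ind eg i (bq_ind eh' i x) by [].
by rewrite !bq_indE eb.
Qed.

Lemma bq_terminal T c : broot T = c ->
  exists f : bqmap T (bq_U c), forall g, g = f.
Proof.
move=> e; exists (@Bqmap T (bq_U c) (fun=> ord0) e) => g.
by apply: bqmap_eq => x; rewrite [LHS]ord1 [RHS]ord1.
Qed.

Lemma bq_ind_cmap T S R (f : bqmap T S) (g : bqmap S R) (h : bqmap T R)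
  (e : h = bq_cmp g f) i (x : 'I_(bar (bq_fib h i))) :
  fin_incl (erefl #|fin_fib g i|) (bq_ind e i x) =
  f (fin_incl (erefl #|fin_fib h i|) x).
Proof. by rewrite !fin_incl_id bq_indE. Qed.

Lemma bq_AX2 T i : exists c, bq_fib (bq_id T) i = bq_U c.
Proof.
have h : fin_fib (bq_id T) i = [set i].
  by apply/setP => x; rewrite !inE.
exists (bcol T i); apply: bouquet_eq => //=; first by rewrite h cards1.
move=> x y _; congr bcol; exact/set1P/(eq_ind _ (fun A : {set 'I_(bar T)} => enum_val x \in A) (enum_valP x) _ h).
Qed.

Lemma fin_incl_setT n k (A : {set 'I_n}) (e : k = #|A|) (x : 'I_k) :
  A = setT -> fin_incl e x = x :> nat.
Proof.
move=> eA; have ek : k = n by rewrite e eA cardsT card_ord.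
case: _ / ek in A e eA *.
rewrite (@fin_incl_unique k k A id) // => y.
by rewrite eA inE; split=> // _; exists y.
Qed.

Lemma bq_fib_UT T c (f : bqmap T (bq_U c)) i : fin_fib f i = setT.
Proof. by apply/setP => x; rewrite !inE (ord1 i) (ord1 (f x)) eqxx. Qed.

Lemma enum_val_U T c (f : bqmap T (bq_U c)) i (x : 'I_#|fin_fib f i|) :
  enum_val x = x :> nat.
Proof. by rewrite -(fin_incl_id erefl) fin_incl_setT // bq_fib_UT. Qed.

Lemma bq_AX3a_ob T c (f : bqmap T (bq_U c)) i : bq_fib f i = T.
Proof.
apply: bouquet_eq => /=; first by rewrite bq_fib_UT cardsT card_ord.
  by rewrite (bqmap_root f).
move=> x y xy; congr bcol; apply: val_inj => /=; rewrite -xy.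
exact: enum_val_U.
Qed.

Lemma bq_AX3a_hom T S c (f : bqmap T S) (g : bqmap S (bq_U c))
  (h : bqmap T (bq_U c)) (e : h = bq_cmp g f) i : arr (bq_ind e i) = arr f.
Proof.
apply: bqarr_eq; [exact: bq_AX3a_ob | exact: bq_AX3a_ob |].
move=> x x' xx'; rewrite -(enum_val_U (bq_ind e i x)) bq_indE; congr (nat_of_ord (f _)).
by apply: val_inj => /=; rewrite -xx' enum_val_U.
Qed.


Lemma bq_restrict T S R (f : bqmap T S) (g : bqmap S R) (h : bqmap T R)
  (e : h = bq_cmp g f) i (x : 'I_(bar T)) :
  f x \in fin_fib g i -> x \in fin_fib h i.
Proof. by rewrite e !inE. Qed.

Lemma bq_fib_incl T S R (f : bqmap T S) (g : bqmap S R) (h : bqmap T R)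
  (e : h = bq_cmp g f) i (j : 'I_(bar (bq_fib g i)))
  (x : 'I_#|fin_fib (bq_ind e i) j|) (y : 'I_#|fin_fib f (enum_val j)|) :
  x = y :> nat ->
  @enum_val _ (mem (fin_fib h i)) (enum_val x) = enum_val y.
Proof.
move=> xy; rewrite -(fin_incl_id erefl) -(fin_incl_id (erefl #|fin_fib h i|)).
have ej : enum_val j = fin_incl (erefl #|fin_fib g i|) j by rewrite fin_incl_id.
move: y xy; rewrite ej => y xy; rewrite -(fin_incl_id erefl y).
exact: (fin_restrict_incl (bq_ind_cmap e (i := i)) (@bq_restrict _ _ _ _ _ _ e i)).
Qed.

Lemma bq_AX4 T S R (f : bqmap T S) (g : bqmap S R) (h : bqmap T R)
  (e : h = bq_cmp g f) i (j : 'I_(bar (bq_fib g i))) :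
  bq_fib (bq_ind e i) j = bq_fib f (fin_incl (erefl #|fin_fib g i|) j).
Proof.
rewrite fin_incl_id; apply: bouquet_eq => /=.
- have ej : enum_val j = fin_incl (erefl #|fin_fib g i|) j by rewrite fin_incl_id.
  rewrite ej.
  exact: (fin_restrict_card (bq_ind_cmap e (i := i)) (@bq_restrict _ _ _ _ _ _ e i)).
- by [].
by move=> x y xy; congr bcol; apply: bq_fib_incl.
Qed.

Lemma bq_AX5 T S Q R (f : bqmap T S) (a : bqmap S Q) (c : bqmap Q R)
    (b : bqmap T Q) (g : bqmap S R) (h : bqmap T R)
    (eb : b = bq_cmp a f) (eg : g = bq_cmp c a) (eh : h = bq_cmp c b)
    (eh' : h = bq_cmp g f) i
    (ei : bq_ind eh i = bq_cmp (bq_ind eg i) (bq_ind eh' i))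
    (j : 'I_(bar (bq_fib c i))) :
    arr (bq_ind ei j) = arr (bq_ind eb (fin_incl (erefl #|fin_fib c i|) j)).
Proof.
have ob1 := bq_AX4 eh j; have ob2 := bq_AX4 eg j.
apply: bqarr_eq; [exact: ob1 | exact: ob2 |].
move: ob1 ob2; rewrite fin_incl_id => ob1 ob2 x x' xx'.
pose u := cast_ord (f_equal (@bar C) ob2) (bq_ind ei j x).
suff <- : u = bq_ind eb (enum_val j) x' by [].
apply: enum_val_inj; rewrite bq_indE -(@bq_fib_incl _ _ _ a c g eg i j (bq_ind ei j x) u) //.
by rewrite !bq_indE; congr (f _); apply: bq_fib_incl.
Qed.

Lemma bq_idl T S (f : bqmap T S) : bq_cmp (bq_id S) f = f.
Proof. exact: bqmap_eq. Qed.

Lemma bq_idr T S (f : bqmap T S) : bq_cmp f (bq_id T) = f.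
Proof. exact: bqmap_eq. Qed.

Lemma bq_cmpA T S R Q (f : bqmap T S) (g : bqmap S R) (h : bqmap R Q) :
  bq_cmp h (bq_cmp g f) = bq_cmp (bq_cmp h g) f.
Proof. exact: bqmap_eq. Qed.

Definition Bq : OpCat := {|
  Ob := bouquet C; Hom := bqmap; idm := bq_id; cmp := bq_cmp;
  cmp_idl := bq_idl; cmp_idr := bq_idr; cmpA := bq_cmpA;
  pi0 := C; pi := @broot C;
  piP := connected_of_terminal bqmap_root bq_terminal;
  U := bq_U; pi_U := fun=> erefl; U_terminal := bq_terminal;
  card := @bar C; cmap := bfun;
  cmap_id := fun T x => erefl; cmap_cmp := fun T S R f g x => erefl;
  fib := bq_fib; fib_card := fun T S f i => erefl;
  AX1 := fun=> erefl; AX2 := bq_AX2;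
  ind := bq_ind; ind_cmap := bq_ind_cmap;
  ind_id := bq_ind_id; ind_cmp := bq_ind_cmp;
  AX3a_ob := bq_AX3a_ob; AX3a_hom := bq_AX3a_hom;
  AX4 := bq_AX4; AX5 := bq_AX5 |}.
End Bouquets.
Arguments Bq C : clear implicits.

Section FibIncl.
Variables (O : OpCat) (T S R : Ob O).
Variables (f : Hom T S) (g : Hom S R) (h : Hom T R) (e : h = cmp g f).
Variable i : 'I_(card R).

Lemma fib_restrict x :
  cmap f x \in fin_fib (cmap g) i -> x \in fin_fib (cmap h) i.
Proof. by rewrite e !inE cmap_cmp. Qed.

Lemma fib_incl j (x : 'I_(card (fib (ind e i) j)))
  (y : 'I_(card (fib f (fin_incl (fib_card g i) j)))) : x = y :> nat ->
  fin_incl (fib_card h i) (fin_incl (fib_card (ind e i) j) x) =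
  fin_incl (fib_card f _) y.
Proof. exact: (fin_restrict_incl (ind_cmap e (i := i)) fib_restrict). Qed.
End FibIncl.

(* The structure of an operad, without its laws. *)
Record OpData (O : OpCat) := {
  op_car :> Ob O -> Type;
  op_unit : forall c, op_car (U c);
  op_mu : forall T S (f : Hom T S),
    (forall i, op_car (fib f i)) -> op_car S -> op_car T
}.
Arguments op_unit {O} o c.
Arguments op_mu {O o T S} f _ _.

Section OperadLaws.
Variables (O : OpCat) (D : OpData O).

(* mu^h((mu^{f_i}((x_j)_{|g|(j) = i}, y_i))_i, z); x_j is transported along
   AX4. *)
Definition mu_assoc T S R (f : Hom T S) (g : Hom S R) (h : Hom T R)
  (e : h = cmp g f) (x : forall j, D (fib f j)) (y : forall i, D (fib g i))
  (z : D R) : D T :=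
  op_mu h (fun i => op_mu (ind e i)
    (fun j => tr (P := D) (esym (AX4 e j)) (x (fin_incl (fib_card g i) j)))
    (y i)) z.

Definition id_units T (i : 'I_(card T)) : D (fib (idm T) i) :=
  tr (P := D) (esym (fib_id_U i)) (op_unit D _).

Definition over_U T c (f : Hom T (U c)) (x : D T) i : D (fib f i) :=
  tr (P := D) (esym (AX3a_ob f i)) x.

(* The operad laws up to a relation E. *)
Definition op_laws (E : forall T, D T -> D T -> Prop) : Prop :=
  [/\ forall T S R (f : Hom T S) (g : Hom S R) (h : Hom T R) (e : h = cmp g f)
        x y z, E T (op_mu f x (op_mu g y z)) (mu_assoc e x y z),
      forall T (x : D T), E T (op_mu (idm T) (@id_units T) x) x
    & forall T c (f : Hom T (U c)) (x : D T),
        E T (op_mu f (over_U f x) (op_unit D c)) x].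

Definition op_congruence (E : forall T, D T -> D T -> Prop) : Prop :=
  [/\ forall T, equivalence (D T) (E T)
    & forall T S (f : Hom T S) x x' y y',
        (forall i, E _ (x i) (x' i)) -> E S y y' ->
        E T (op_mu f x y) (op_mu f x' y')].

Lemma mu_congr T S T' S' (f : Hom T S) (f' : Hom T' S')
  (x : forall i, D (fib f i)) (x' : forall i, D (fib f' i))
  (y : D S) (y' : D S') :
  arr f = arr f' ->
  (forall (i : 'I_(card S)) (i' : 'I_(card S')), i = i' :> nat ->
    pk (x i) = pk (x' i')) ->
  pk y = pk y' -> pk (op_mu f x y) = pk (op_mu f' x' y').
Proof.
move=> ef.
have gen : forall a b : {TS : Ob O * Ob O & Hom TS.1 TS.2}, a = b ->
  forall (x : forall i, D (fib (projT2 a) i)) (x' : forall i, D (fib (projT2 b) i))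
  (y : D (projT1 a).2) (y' : D (projT1 b).2),
  (forall (i : 'I_(card (projT1 a).2)) (i' : 'I_(card (projT1 b).2)),
    i = i' :> nat -> pk (x i) = pk (x' i')) -> pk y = pk y' ->
  pk (op_mu (projT2 a) x y) = pk (op_mu (projT2 b) x' y').
  move=> a b e; subst b => u u' v v' uu /(@pk_inj _ D) ->; congr pk; congr op_mu.
  by apply: functional_extensionality_dep => i; apply: pk_inj; apply: uu.
exact: (gen _ _ ef).
Qed.
End OperadLaws.

Record Operad (O : OpCat) := {
  op_data :> OpData O;
  op_lawsP : op_laws (D := op_data) (fun T => @eq (op_data T))
}.

Section OperadTheory.
Variables (O : OpCat) (P : Operad O).

Lemma op_assoc T S R (f : Hom T S) (g : Hom S R) (h : Hom T R)
  (e : h = cmp g f) (x : forall j, P (fib f j)) (y : forall i, P (fib g i))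
  (z : P R) : op_mu f x (op_mu g y z) = mu_assoc e x y z.
Proof. by case: (op_lawsP P). Qed.

Lemma op_unitl T (x : P T) : op_mu (idm T) (id_units P (T := T)) x = x.
Proof. by case: (op_lawsP P). Qed.

Lemma op_unitr T c (f : Hom T (U c)) (x : P T) :
  op_mu f (over_U f x) (op_unit P c) = x.
Proof. by case: (op_lawsP P). Qed.

Lemma unit_pk c c' : c = c' -> pk (op_unit P c) = pk (op_unit P c').
Proof. by move=> ->. Qed.

Lemma pk_unitl T (f : Hom T T) (x : forall i, P (fib f i)) (y : P T) :
  f = idm T -> (forall i, exists c, pk (x i) = pk (op_unit P c)) ->
  op_mu f x y = y.
Proof.
move=> ef; case: _ / (esym ef) in x * => xu; rewrite -[RHS]op_unitl.
congr op_mu; apply: functional_extensionality_dep => i; apply: pk_inj.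
have [c xc] := xu i; rewrite xc pk_tr; apply: unit_pk.
by have := f_equal (fun t => pi (projT1 t)) xc; rewrite /= pi_U.
Qed.

Lemma pk_unitr T S c (f : Hom T S) (x : forall i, P (fib f i)) (y : P S)
  (z : P T) : pk y = pk (op_unit P c) -> (forall i, pk (x i) = pk z) ->
  op_mu f x y = z.
Proof.
move=> ey; have eS : S = U c := f_equal (@projT1 _ _) ey.
subst S; move/(@pk_inj _ P): ey => -> xz.
rewrite -[RHS](op_unitr f); congr op_mu.
apply: functional_extensionality_dep => i; apply: pk_inj.
by rewrite pk_tr xz.
Qed.

Lemma pk_over_U T c (f : Hom T (U c)) (x : forall i, P (fib f i)) i :
  pk (x i) = pk (op_mu f x (op_unit P c)).
Proof.
rewrite -[LHS](pk_tr (AX3a_ob f i)); congr pk; symmetry.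
apply: (pk_unitr (c := c)) => // j; rewrite pk_tr.
by rewrite (U_ord j i).
Qed.
End OperadTheory.

Record OpHom (O : OpCat) (P Q : Operad O) := {
  op_fun : forall T, P T -> Q T;
  op_fun_unit : forall c, op_fun (op_unit P c) = op_unit Q c;
  op_fun_mu : forall T S (f : Hom T S) (x : forall i, P (fib f i)) (y : P S),
    op_fun (op_mu f x y) = op_mu f (fun i => op_fun (x i)) (op_fun y)
}.

Section Grothendieck.
Variables (O : OpCat) (P : Operad O).

Definition g_ob := {T : Ob O & P T}.
Implicit Types t s r : g_ob.

Record g_hom t s := GHom {
  g_map : Hom (projT1 t) (projT1 s);
  g_eps : forall i, P (fib g_map i);
  g_mu : op_mu g_map g_eps (projT2 s) = projT2 t
}.

Lemma g_hom_eq t s (f f' : g_hom t s) : g_map f = g_map f' ->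
  (forall (i i' : 'I_(card (projT1 s))), i = i' :> nat -> pk (g_eps f i) = pk (g_eps f' i')) -> f = f'.
Proof.
case: f => f x ef; case: f' => f' x' ef' /= eff.
subst f' => xx.
have exx : x = x'.
  by apply: functional_extensionality_dep => i; apply: pk_inj; apply: xx.
by subst x'; rewrite (Prop_irrelevance ef ef').
Qed.

Lemma g_arr_eq t s t' s' (f : g_hom t s) (f' : g_hom t' s') :
  t = t' -> s = s' -> arr (g_map f) = arr (g_map f') ->
  (forall (i : 'I_(card (projT1 s))) (i' : 'I_(card (projT1 s'))),
    i = i' :> nat -> pk (g_eps f i) = pk (g_eps f' i')) ->
  arr f = arr f'.
Proof.
move=> et es; case: _ / et in f' *; case: _ / es in f' *.
by move=> ef xx; congr (arr _); apply: g_hom_eq => //; apply: arr_inj.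
Qed.

Lemma g_eps_map t s (f f' : g_hom t s) : f = f' ->
  forall (i i' : 'I_(card (projT1 s))), i = i' :> nat -> pk (g_eps f i) = pk (g_eps f' i').
Proof. by move=> e; case: _ / e => i i' /val_inj ->. Qed.

Lemma g_eps_pk t s (f : g_hom t s)
  (i i' : 'I_(card (projT1 s))) : i = i' :> nat ->
  pk (g_eps f i) = pk (g_eps f i').
Proof. by move=> /val_inj ->. Qed.

Definition g_id t : g_hom t t := GHom (op_unitl (projT2 t)).

Definition g_restr t s r (f : g_hom t s) (g : g_hom s r)
  (h : Hom (projT1 t) (projT1 r)) (e : h = cmp (g_map g) (g_map f)) i j :
  P (fib (ind e i) j) :=
  tr (P := P) (esym (AX4 e j)) (g_eps f (fin_incl (fib_card (g_map g) i) j)).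

(* The family of the kappa_i of the composite (delta, g)(epsilon, f). *)
Definition g_kappa t s r (g : g_hom s r) (f : g_hom t s) i :
  P (fib (cmp (g_map g) (g_map f)) i) :=
  op_mu (ind erefl i) (g_restr erefl (i := i)) (g_eps g i).

Lemma g_cmp_mu t s r (g : g_hom s r) (f : g_hom t s) :
  op_mu (cmp (g_map g) (g_map f)) (g_kappa g f) (projT2 r) = projT2 t.
Proof. by rewrite -(g_mu f) -(g_mu g) (op_assoc erefl). Qed.

Definition g_cmp t s r (g : g_hom s r) (f : g_hom t s) : g_hom t r :=
  GHom (g_cmp_mu g f).

Definition g_fib t s (f : g_hom t s) (i : 'I_(card (projT1 s))) : g_ob :=
  existT P (fib (g_map f) i) (g_eps f i).

Definition g_map_cmp t s r (f : g_hom t s) (g : g_hom s r) (h : g_hom t r)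
  (e : h = g_cmp g f) : g_map h = cmp (g_map g) (g_map f) :=
  f_equal (@g_map t r) e.

Lemma g_ind_mu t s r (f : g_hom t s) (g : g_hom s r) (h : g_hom t r)
  (e : h = g_cmp g f) i :
  op_mu (ind (g_map_cmp e) i) (g_restr (g_map_cmp e) (i := i)) (g_eps g i) =
  g_eps h i.
Proof.
move: (g_map_cmp e); case: _ / (esym e) => /= e'.
by rewrite (Prop_irrelevance e' erefl).
Qed.

Definition g_ind t s r (f : g_hom t s) (g : g_hom s r) (h : g_hom t r)
  (e : h = g_cmp g f) i : g_hom (g_fib h i) (g_fib g i) :=
  @GHom (g_fib h i) (g_fib g i) _ _ (g_ind_mu e i).

Definition g_U c : g_ob := existT P (U c) (op_unit P c).

Lemma g_map_pi t s (f : g_hom t s) : pi (projT1 t) = pi (projT1 s).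
Proof. exact: pi_hom (g_map f). Qed.

Lemma g_terminal t c : pi (projT1 t) = c ->
  exists f : g_hom t (g_U c), forall g, g = f.
Proof.
case: t => T x /= /U_terminal [f fU].
exists (@GHom (existT P T x) (g_U c) f (over_U f x) (op_unitr f x)) => g.
apply: g_hom_eq => /=; first exact: U_hom_uniq.
move=> i i' _; rewrite pk_tr pk_over_U.
by have /= -> := g_mu g.
Qed.

Lemma g_AX2 t i : exists c, g_fib (g_id t) i = g_U c.
Proof. by exists (pi (fib (idm (projT1 t)) i)); apply: pk_tr. Qed.

Lemma g_AX3a_ob t c (f : g_hom t (g_U c)) i : g_fib f i = t.
Proof.
rewrite /g_fib; have := pk_over_U (g_eps f) i; have /= -> := g_mu f.
by rewrite /pk => ->; case: t f.
Qed.

Lemma g_AX4 t s r (f : g_hom t s) (g : g_hom s r) (h : g_hom t r)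
  (e : h = g_cmp g f) i (j : 'I_(card (fib (g_map g) i))) :
  g_fib (g_ind e i) j = g_fib f (fin_incl (fib_card (g_map g) i) j).
Proof. exact: pk_tr. Qed.

Lemma g_AX3a_hom t s c (f : g_hom t s) (g : g_hom s (g_U c))
  (h : g_hom t (g_U c)) (e : h = g_cmp g f) i : arr (g_ind e i) = arr f.
Proof.
apply: g_arr_eq; [exact: g_AX3a_ob | exact: g_AX3a_ob | exact: AX3a_hom |].
move=> j j' jj'; rewrite pk_tr; apply: g_eps_pk; rewrite -jj'.
apply: fin_incl_setT; apply/setP => x; rewrite !inE; apply/eqP.
exact: U_ord.
Qed.

Lemma g_AX5 t s q r (f : g_hom t s) (a : g_hom s q) (c : g_hom q r)
    (b : g_hom t q) (g : g_hom s r) (h : g_hom t r)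
    (eb : b = g_cmp a f) (eg : g = g_cmp c a) (eh : h = g_cmp c b)
    (eh' : h = g_cmp g f) i
    (ei : g_ind eh i = g_cmp (g_ind eg i) (g_ind eh' i))
    (j : 'I_(card (fib (g_map c) i))) :
    arr (g_ind ei j) = arr (g_ind eb (fin_incl (fib_card (g_map c) i) j)).
Proof.
apply: g_arr_eq; [exact: g_AX4 | exact: g_AX4 | exact: AX5 |].
move=> k k' kk'; rewrite !pk_tr; apply: g_eps_pk.
by congr nat_of_ord; apply: fib_incl.
Qed.

Lemma g_idl t s (f : g_hom t s) : g_cmp (g_id s) f = f.
Proof.
apply: g_hom_eq => /= [|i i' ii']; first exact: cmp_idl.
transitivity (pk (g_eps f i)); last exact: g_eps_pk.
have e : fib (cmp (idm (projT1 s)) (g_map f)) i = fib (g_map f) i.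
  by rewrite cmp_idl.
rewrite -(pk_tr (esym e) (g_eps f i)); congr pk.
apply: (pk_unitr (c := pi (fib (idm (projT1 s)) i))); first exact: pk_tr.
move=> j; rewrite !pk_tr; apply: g_eps_pk; congr nat_of_ord.
by rewrite -[LHS]cmap_id fin_fibP.
Qed.

Lemma g_ind_id s r (g : g_hom s r) (e : g = g_cmp g (g_id s)) i :
  g_ind e i = g_id (g_fib g i).
Proof.
apply: g_hom_eq => /= [|j j' jj']; first exact: ind_id.
rewrite !pk_tr; apply: unit_pk; congr pi.
by rewrite -(AX4 (g_map_cmp e)); apply: fib_congr => //; rewrite ind_id.
Qed.

Lemma g_idr t s (f : g_hom t s) : g_cmp f (g_id t) = f.
Proof.
apply: g_hom_eq => /= [|i i' ii']; first exact: cmp_idr.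
transitivity (pk (g_eps f i)); last exact: g_eps_pk.
have e : fib (cmp (g_map f) (idm (projT1 t))) i = fib (g_map f) i.
  by rewrite cmp_idr.
rewrite /g_kappa.
have gen : forall (h : Hom (projT1 t) (projT1 s))
  (e : h = cmp (g_map f) (g_map (g_id t))),
  pk (op_mu (ind e i) (g_restr e (i := i)) (g_eps f i)) = pk (g_eps f i).
  move=> h e'; have e2 := etrans e' (cmp_idr (g_map f)).
  case: _ / (esym e2) in e' *; congr pk.
  apply: pk_unitl; first exact: ind_id.
  by move=> j; exists (pi (fib (idm (projT1 t)) (fin_incl (fib_card (g_map f) i) j)));
    rewrite !pk_tr.
exact: gen.
Qed.

Lemma g_ind_cmp t s q r (f : g_hom t s) (a : g_hom s q) (c : g_hom q r)
    (b : g_hom t q) (g : g_hom s r) (h : g_hom t r)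
    (eb : b = g_cmp a f) (eg : g = g_cmp c a) (eh : h = g_cmp c b)
    (eh' : h = g_cmp g f) i :
    g_ind eh i = g_cmp (g_ind eg i) (g_ind eh' i).
Proof.
have ei : ind (g_map_cmp eh) i = cmp (ind (g_map_cmp eg) i) (ind (g_map_cmp eh') i).
  exact: ind_cmp (g_map_cmp eb) _ _ _ _.
apply: g_hom_eq => //= j j' /val_inj <-.
rewrite pk_tr; set j0 := fin_incl _ j.
rewrite -(g_ind_mu eb j0) /g_kappa /=.
have gen : forall (k : Hom (fib (g_map h) i) (fib (g_map c) i))
  (e : k = cmp (ind (g_map_cmp eg) i) (ind (g_map_cmp eh') i)), 
  pk (op_mu (ind (g_map_cmp eb) j0) (g_restr (g_map_cmp eb) (i:=j0)) (g_eps a j0)) =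
  pk (op_mu (ind e j) (@g_restr _ _ _ (g_ind eh' i) (g_ind eg i) k e j) (g_eps (g_ind eg i) j)).
  move=> k e; have e2 := etrans e (esym ei); case: _ / (esym e2) in e *.
  apply: mu_congr.
  - exact: esym (AX5 (g_map_cmp eb) e j).
  - move=> l l' ll'; rewrite !pk_tr; apply: g_eps_pk.
    by congr nat_of_ord; symmetry; apply: fib_incl.
  - by rewrite /= pk_tr.
exact: gen.
Qed.

Lemma g_cmpA t s r q (f : g_hom t s) (g : g_hom s r) (h : g_hom r q) :
  g_cmp h (g_cmp g f) = g_cmp (g_cmp h g) f.
Proof.
apply: g_hom_eq => /= [|i i' /val_inj <-]; first exact: cmpA.
have gen : forall (k k' : Hom (projT1 t) (projT1 q))
  (e : k = cmp (g_map h) (g_map (g_cmp g f)))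
  (e' : k' = cmp (g_map (g_cmp h g)) (g_map f)),
  pk (op_mu (ind e i) (g_restr e (i := i)) (g_eps h i)) =
  pk (op_mu (ind e' i) (g_restr e' (i := i)) (g_eps (g_cmp h g) i)).
  move=> k k' e e'; have e2 : k' = k by rewrite e e' /= cmpA.
  case: _ / e2 in e e' *; congr pk.
  have ei : ind e i =
    cmp (@ind O _ _ _ (g_map g) (g_map h) (g_map (g_cmp h g)) erefl i) (ind e' i).
    exact: ind_cmp erefl _ _ _ _.
  rewrite [g_eps (g_cmp h g) i]/= /g_kappa (op_assoc ei).
  rewrite /mu_assoc; congr op_mu; apply: functional_extensionality_dep => j.
  apply: pk_inj; rewrite pk_tr /= /g_kappa; apply: mu_congr.
  - exact: esym (AX5 erefl ei j).
  - move=> l l' ll'; rewrite !pk_tr; apply: g_eps_pk.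
    by congr nat_of_ord; symmetry; apply: fib_incl.
  - by rewrite pk_tr.
exact: gen.
Qed.

(* The operadic Grothendieck construction; for O = Bq C it is the value of the
   functor I at P. *)
Definition Groth : OpCat := {|
  Ob := g_ob; Hom := g_hom; idm := g_id; cmp := g_cmp;
  cmp_idl := g_idl; cmp_idr := g_idr; cmpA := g_cmpA;
  pi0 := pi0 O; pi := fun t => pi (projT1 t);
  piP := connected_of_terminal g_map_pi g_terminal;
  U := g_U; pi_U := @pi_U O; U_terminal := g_terminal;
  card := fun t => card (projT1 t); cmap := fun t s f => cmap (g_map f);
  cmap_id := fun t => @cmap_id O (projT1 t);
  cmap_cmp := fun t s r f g => cmap_cmp (g_map f) (g_map g);
  fib := g_fib; fib_card := fun t s f => fib_card (g_map f);
  AX1 := @AX1 O; AX2 := g_AX2;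
  ind := g_ind;
  ind_cmap := fun t s r f g h e => ind_cmap (g_map_cmp e);
  ind_id := g_ind_id; ind_cmp := g_ind_cmp;
  AX3a_ob := g_AX3a_ob; AX3a_hom := g_AX3a_hom;
  AX4 := g_AX4; AX5 := g_AX5 |}.
End Grothendieck.

Section Wreath.
Variables O R : OpCat.

(* wd is the common component of the Y_i.  It is extra data only when X has
   cardinality 0. *)
Record wr_ob := WrOb {
  wX : Ob O;
  wY : 'I_(card wX) -> Ob R;
  wd : pi0 R;
  wdP : forall i, pi (wY i) = wd
}.
Arguments wY : clear implicits.
Implicit Types W V Z : wr_ob.

(* wPhi is the family of the phi_ij : Y_i -> W_j with |phi|(i) = j. *)
Record wr_hom W V := WrHom {
  wphi : Hom (wX W) (wX V);
  wPhi : forall i j, cmap wphi i = j -> Hom (wY W i) (wY V j);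
  wd_eq : wd W = wd V
}.

Lemma wr_ob_eq W V : wX W = wX V ->
  (forall (i : 'I_(card (wX W))) (i' : 'I_(card (wX V))),
     i = i' :> nat -> wY W i = wY V i') -> wd W = wd V -> W = V.
Proof.
case: W => X Y d p; case: V => X' Y' d' p' /= eX; subst X' => eY ed.
have e : Y = Y' by apply: funext => i; apply: eY.
by subst Y' d'; congr WrOb; apply: Prop_irrelevance.
Qed.

Lemma wr_hom_eq W V (f g : wr_hom W V) : wphi f = wphi g ->
  (forall i j (e : cmap (wphi f) i = j) (e' : cmap (wphi g) i = j),
     wPhi e = wPhi e') -> f = g.
Proof.
case: f => f F d; case: g => g G d' /= efg; subst g => eFG.
have e : F = G.
  by do 3!apply: functional_extensionality_dep => ?; apply: eFG.
by subst G; rewrite (Prop_irrelevance d d').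
Qed.

Lemma wr_arr_eq W V W' V' (f : wr_hom W V) (f' : wr_hom W' V') :
  W = W' -> V = V' -> arr (wphi f) = arr (wphi f') ->
  (forall (i : 'I_(card (wX W))) (j : 'I_(card (wX V))) (e : cmap (wphi f) i = j)
     (i' : 'I_(card (wX W'))) (j' : 'I_(card (wX V'))) (e' : cmap (wphi f') i' = j'),
     i = i' :> nat -> j = j' :> nat -> arr (wPhi e) = arr (wPhi e')) ->
  arr f = arr f'.
Proof.
move=> eW eV; subst W' V' => ef eF; congr (arr _); apply: wr_hom_eq.
  exact: arr_inj.
by move=> i j e e'; apply: arr_inj; apply: eF.
Qed.

Lemma wPhi_arr W V (f : wr_hom W V) i j (e : cmap (wphi f) i = j) i' j'
  (e' : cmap (wphi f) i' = j') : i = i' -> j = j' ->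
  arr (wPhi e) = arr (wPhi e').
Proof. 
move=> ei ej; move: e'; case: _ / ei; case: _ / ej => e'.
by rewrite (Prop_irrelevance e e'). Qed.

Lemma wPhi_congr W V (f g : wr_hom W V) i j (e : cmap (wphi f) i = j)
  (e' : cmap (wphi g) i = j) : f = g -> wPhi e = wPhi e'.
Proof. by move=> efg; subst g; rewrite (Prop_irrelevance e e'). Qed.

Lemma wr_id_eq W (i j : 'I_(card (wX W))) : cmap (idm (wX W)) i = j -> i = j.
Proof. by rewrite cmap_id. Qed.

Definition wr_id W : wr_hom W W :=
  @WrHom W W (idm (wX W))
    (fun i j e => tr (P := fun k => Hom (wY W i) (wY W k)) (wr_id_eq e)
                     (idm (wY W i)))
    erefl.

Lemma wr_cmp_eq (T S Q : Ob O) (g : Hom S Q) (f : Hom T S) i k :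
  cmap (cmp g f) i = k -> cmap g (cmap f i) = k.
Proof. by rewrite cmap_cmp. Qed.

Definition wr_cmp W V Z (g : wr_hom V Z) (f : wr_hom W V) : wr_hom W Z :=
  @WrHom W Z (cmp (wphi g) (wphi f))
    (fun i k e => cmp (wPhi (wr_cmp_eq e)) (wPhi (erefl (cmap (wphi f) i))))
    (etrans (wd_eq f) (wd_eq g)).

Lemma wr_id_Phi W i j (e : cmap (wphi (wr_id W)) i = j) :
  arr (wPhi e) = arr (idm (wY W i)).
Proof. by rewrite /=; move: (wr_id_eq e) => e'; case: _ / e' {e}. Qed.

Lemma wr_cmp_Phi W V Z (g : wr_hom V Z) (f : wr_hom W V) (h : wr_hom W Z)
  (e : h = wr_cmp g f) i j k (eij : cmap (wphi f) i = j)
  (ejk : cmap (wphi g) j = k) (eik : cmap (wphi h) i = k) :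
  wPhi eik = cmp (wPhi ejk) (wPhi eij).
Proof.
subst h j; rewrite /=; congr (cmp (wPhi _) _); exact: Prop_irrelevance.
Qed.

Lemma wr_idl W V (f : wr_hom W V) : wr_cmp (wr_id V) f = f.
Proof.
apply: wr_hom_eq => [|i j e e'] /=; first exact: cmp_idl.
move: (wr_id_eq _) => e2; rewrite (Prop_irrelevance e' e2).
by move: e2 {e e'} => e2; subst j; rewrite cmp_idl.
Qed.

Lemma wr_idr W V (f : wr_hom W V) : wr_cmp f (wr_id W) = f.
Proof.
apply: wr_hom_eq => [|i j e e'] /=; first exact: cmp_idr.
have gen : forall i' (e2 : i = i') (e1 : cmap (wphi f) i' = j),
  cmp (wPhi e1) (tr (P := fun k => Hom (wY W i) (wY W k)) e2 (idm (wY W i))) =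
  wPhi e'.
  move=> i' e2; case: _ / e2 => e1.
  by rewrite cmp_idr (Prop_irrelevance e1 e').
exact: gen.
Qed.

Lemma wr_cmpA W V Z Q (f : wr_hom W V) (g : wr_hom V Z) (h : wr_hom Z Q) :
  wr_cmp h (wr_cmp g f) = wr_cmp (wr_cmp h g) f.
Proof.
apply: wr_hom_eq => [|i j e e']; first exact: cmpA.
have e1 : cmap (wphi (wr_cmp g f)) i = cmap (wphi g) (cmap (wphi f) i).
  exact: cmap_cmp.
have e2 : cmap (wphi h) (cmap (wphi g) (cmap (wphi f) i)) = j.
  by rewrite -e !cmap_cmp.
have e3 : cmap (wphi (wr_cmp h g)) (cmap (wphi f) i) = j.
  by rewrite -e2 [LHS]cmap_cmp.
rewrite (wr_cmp_Phi erefl e1 e2 e) (wr_cmp_Phi erefl erefl e3 e').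
by rewrite (wr_cmp_Phi erefl erefl erefl e1) (wr_cmp_Phi erefl erefl e2 e3) cmpA.
Qed.

(* The ordered sum of the |Y_i|, identified by tagnat with the lexicographically
   ordered set of pairs of an i and an element of |Y_i|. *)
Definition wr_card W := \sum_i card (wY W i).
Definition wr_fst W (p : 'I_(wr_card W)) : 'I_(card (wX W)) := tagnat.sig1 p.
Definition wr_snd W (p : 'I_(wr_card W)) : 'I_(card (wY W (wr_fst p))) :=
  tagnat.sig2 p.
Definition wr_pair W i (x : 'I_(card (wY W i))) : 'I_(wr_card W) :=
  @tagnat.Rank _ (fun i => card (wY W i)) i x.

Lemma wr_pairK W (p : 'I_(wr_card W)) : wr_pair (wr_snd p) = p.
Proof. exact: tagnat.sig2K. Qed.

Lemma wr_fstK W i (x : 'I_(card (wY W i))) : wr_fst (wr_pair x) = i.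
Proof. exact: tagnat.Rank1K. Qed.

Lemma wr_sndK W i (x : 'I_(card (wY W i))) : wr_snd (wr_pair x) = x :> nat.
Proof.
have /eqP := wr_pairK (wr_pair x).
by rewrite -val_eqE /= tagnat.eq_Rank => /andP[_ /eqP].
Qed.

Lemma wr_pair_eq W i (x : 'I_(card (wY W i))) i' (x' : 'I_(card (wY W i'))) :
  i = i' -> x = x' :> nat -> wr_pair x = wr_pair x'.
Proof. by move=> ei; subst i' => /val_inj ->. Qed.

Lemma wr_pair_inj W i (x : 'I_(card (wY W i))) i' (x' : 'I_(card (wY W i'))) :
  wr_pair x = wr_pair x' -> i = i' /\ x = x' :> nat.
Proof.
by move=> /eqP; rewrite -val_eqE /= tagnat.eq_Rank => /andP[/eqP ? /eqP ?].
Qed.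

Lemma wr_pair_lt W i (x : 'I_(card (wY W i))) i' (x' : 'I_(card (wY W i'))) :
  (wr_pair x < wr_pair x') = (i < i') || (i == i') && (x < x').
Proof.
have := @tagnat.lt_rank _ (fun i => card (wY W i)) (Tagged _ x) (Tagged _ x').
rewrite ltEsig /= ltEord => ->; rewrite !leEord !ltEord.
case: (ltngtP i i') => //= [ii'|/val_inj ii'].
  by case: eqP => // e; subst i'; rewrite ltnn in ii'.
by subst i'; rewrite eqxx tagged_asE.
Qed.

Lemma wr_pairP W (p : 'I_(wr_card W)) : exists i x, p = @wr_pair W i x.
Proof. by exists (wr_fst p), (wr_snd p); rewrite wr_pairK. Qed.

Definition wr_cmap W V (f : wr_hom W V) (p : 'I_(wr_card W)) : 'I_(wr_card V) :=
  wr_pair (cmap (wPhi (erefl (cmap (wphi f) (wr_fst p)))) (wr_snd p)).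

Lemma wr_cmap_pair W V (f : wr_hom W V) i (x : 'I_(card (wY W i))) j
  (e : cmap (wphi f) i = j) : wr_cmap f (wr_pair x) = wr_pair (cmap (wPhi e) x).
Proof.
apply: wr_pair_eq; first by rewrite wr_fstK.
by apply: cmap_arr; rewrite ?wr_sndK //; apply: wPhi_arr; rewrite wr_fstK.
Qed.

(* The fiber over the element of |V| given by t and i in |W_t|. *)
Definition wr_fib2 W V (f : wr_hom W V) t (i : 'I_(card (wY V t))) : wr_ob :=
  @WrOb (fib (wphi f) t)
    (fun s => fib (wPhi (fin_fibP (fib_card (wphi f) t) s)) i)
    (pi (fib (idm (wY V t)) i))
    (fun s => pi_fib _ i).
Definition wr_fib W V (f : wr_hom W V) (q : 'I_(wr_card V)) : wr_ob :=
  wr_fib2 f (wr_snd q).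

Lemma wr_fib2_eq W V (f : wr_hom W V) t (i : 'I_(card (wY V t)))
  t' (i' : 'I_(card (wY V t'))) : t = t' -> i = i' :> nat ->
  wr_fib2 f i = wr_fib2 f i'.
Proof. by move=> et; subst t' => /val_inj ->. Qed.

Lemma wr_fib_pair W V (f : wr_hom W V) t (i : 'I_(card (wY V t))) :
  wr_fib f (wr_pair i) = wr_fib2 f i.
Proof. by apply: wr_fib2_eq; rewrite ?wr_fstK ?wr_sndK. Qed.

Section WrFibIncl.
Variables (W V : wr_ob) (f : wr_hom W V) (t : 'I_(card (wX V))).
Variable i : 'I_(card (wY V t)).

Definition wr_incl (z : 'I_(wr_card (wr_fib2 f i))) : 'I_(wr_card W) :=
  wr_pair (fin_incl (fib_card (wPhi (fin_fibP (fib_card (wphi f) t) (wr_fst z))) i)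
    (wr_snd z)).

Lemma wr_incl_pair s (x : 'I_(card (wY (wr_fib2 f i) s))) :
  wr_incl (wr_pair x) =
  wr_pair (fin_incl (fib_card (wPhi (fin_fibP (fib_card (wphi f) t) s)) i) x).
Proof.
rewrite /wr_incl; have := wr_fstK x; have := wr_sndK x.
move: (wr_fst _) (wr_snd _) => s' x' xx' ss'; subst s'.
by rewrite (val_inj xx').
Qed.

Lemma wr_incl_mono (z z' : 'I_(wr_card (wr_fib2 f i))) : z < z' -> wr_incl z < wr_incl z'.
Proof.
have [s [x ->]] := wr_pairP z; have [s' [x' ->]] := wr_pairP z'.
rewrite !wr_incl_pair !wr_pair_lt => /orP[ss'|/andP[/eqP ss' xx']].
  by rewrite fin_incl_mono.
by subst s'; apply/orP; right; rewrite eqxx; apply: fin_incl_mono.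
Qed.

Lemma wr_incl_img p :
  (p \in fin_fib (wr_cmap f) (wr_pair i)) <-> exists z, wr_incl z = p.
Proof.
rewrite inE; split; last first.
  move=> [z <-]; have [s [x ->]] := wr_pairP z; rewrite wr_incl_pair.
  rewrite (wr_cmap_pair _ (fin_fibP (fib_card (wphi f) t) s)).
  by rewrite fin_fibP.
have [a [y ->]] := wr_pairP p; move=> /eqP.
rewrite (wr_cmap_pair _ erefl) => /wr_pair_inj [e1 e2].
have /(fin_incl_surj (fib_card (wphi f) t)) [s es] : a \in fin_fib (cmap (wphi f)) t.
  by rewrite inE e1.
subst a.
have /(fin_incl_surj (fib_card (wPhi (fin_fibP (fib_card (wphi f) t) s)) i)) [x ex] :
  y \in fin_fib (cmap (wPhi (fin_fibP (fib_card (wphi f) t) s))) i.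
  rewrite inE -val_eqE /= -e2; apply/eqP; apply: cmap_arr => //.
  exact: wPhi_arr.
exists (@wr_pair (wr_fib2 f i) s x); rewrite wr_incl_pair.
by apply: wr_pair_eq => //; rewrite ex.
Qed.

Lemma wr_fib2_card : wr_card (wr_fib2 f i) = #|fin_fib (wr_cmap f) (wr_pair i)|.
Proof. exact: fin_card_unique wr_incl_mono wr_incl_img. Qed.

Lemma wr_inclE (e : wr_card (wr_fib2 f i) = #|fin_fib (wr_cmap f) (wr_pair i)|) z :
  fin_incl e z = wr_incl z.
Proof. exact: fin_incl_unique wr_incl_mono wr_incl_img _ _. Qed.
End WrFibIncl.

Lemma wr_fib_card W V (f : wr_hom W V) q :
  wr_card (wr_fib f q) = #|fin_fib (wr_cmap f) q|.
Proof. by rewrite wr_fib2_card wr_pairK. Qed.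

Lemma wr_incl_fib W V (f : wr_hom W V) q (z : 'I_(wr_card (wr_fib f q))) :
  fin_incl (wr_fib_card f q) z = wr_incl z.
Proof.
have gen q' : q' = wr_pair (wr_snd q) ->
  forall e : wr_card (wr_fib f q) = #|fin_fib (wr_cmap f) q'|,
  fin_incl e z = wr_incl z.
  by move=> -> e; apply: wr_inclE.
exact: gen (esym (wr_pairK q)) _.
Qed.

Definition wr_map_cmp W V Z (f : wr_hom W V) (g : wr_hom V Z) (h : wr_hom W Z)
  (e : h = wr_cmp g f) : wphi h = cmp (wphi g) (wphi f) :=
  f_equal (@wphi W Z) e.

Section WrInd.
Variables (W V Z : wr_ob) (f : wr_hom W V) (g : wr_hom V Z) (h : wr_hom W Z).
Variable e : h = wr_cmp g f.

Definition wr_ind1 a b c (e1 : cmap (wphi f) a = b) (e2 : cmap (wphi g) b = c)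
  (e3 : cmap (wphi h) a = c) (i : 'I_(card (wY Z c))) :
  Hom (fib (wPhi e3) i) (fib (wPhi e2) i) :=
  ind (wr_cmp_Phi e e1 e2 e3) i.

Lemma wr_ind1_arr a b c (e1 : cmap (wphi f) a = b) (e2 : cmap (wphi g) b = c)
  (e3 : cmap (wphi h) a = c) (i : 'I_(card (wY Z c)))
  a' b' c' (e1' : cmap (wphi f) a' = b') (e2' : cmap (wphi g) b' = c')
  (e3' : cmap (wphi h) a' = c') (i' : 'I_(card (wY Z c'))) :
  a = a' -> b = b' -> c = c' -> i = i' :> nat ->
  arr (wr_ind1 e1 e2 e3 i) = arr (wr_ind1 e1' e2' e3' i').
Proof.
move=> ea eb ec; move: e1' e2' e3' i'; case: _ / ea; case: _ / eb; case: _ / ec.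
move=> e1' e2' e3' i' /val_inj <-.
by rewrite (Prop_irrelevance e1 e1') (Prop_irrelevance e2 e2')
  (Prop_irrelevance e3 e3').
Qed.

Lemma wr_ind_incl t s s' : cmap (ind (wr_map_cmp e) t) s = s' ->
  cmap (wphi f) (fin_incl (fib_card (wphi h) t) s) =
  fin_incl (fib_card (wphi g) t) s'.
Proof. by move=> <-; rewrite ind_cmap. Qed.

Definition wr_ind2 t (i : 'I_(card (wY Z t))) :
  wr_hom (wr_fib2 h i) (wr_fib2 g i) :=
  @WrHom (wr_fib2 h i) (wr_fib2 g i) (ind (wr_map_cmp e) t)
    (fun s s' es => wr_ind1 (wr_ind_incl es)
       (fin_fibP (fib_card (wphi g) t) s') (fin_fibP (fib_card (wphi h) t) s) i)
    erefl.

Definition wr_ind (q : 'I_(wr_card Z)) : wr_hom (wr_fib h q) (wr_fib g q) :=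
  wr_ind2 (wr_snd q).

Lemma wr_ind2_arr t (i : 'I_(card (wY Z t))) t' (i' : 'I_(card (wY Z t'))) :
  t = t' -> i = i' :> nat -> arr (wr_ind2 i) = arr (wr_ind2 i').
Proof. by move=> et; subst t' => /val_inj ->. Qed.

Lemma wr_ind_pair t (i : 'I_(card (wY Z t))) :
  arr (wr_ind (wr_pair i)) = arr (wr_ind2 i).
Proof. by apply: wr_ind2_arr; rewrite ?wr_fstK ?wr_sndK. Qed.

Lemma wr_ind_cmap q z :
  fin_incl (wr_fib_card g q) (wr_cmap (wr_ind q) z) =
  wr_cmap f (fin_incl (wr_fib_card h q) z).
Proof.
rewrite !wr_incl_fib /wr_ind; move: z; rewrite /wr_fib.
move: (wr_snd q); move: (wr_fst q) => t i z {q}.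
have [s [x ->]] := wr_pairP z.
rewrite (wr_cmap_pair _ erefl) !wr_incl_pair (wr_cmap_pair _ (wr_ind_incl erefl)).
by apply: wr_pair_eq => //; exact: (f_equal val (ind_cmap (wr_cmp_Phi e _ _ _) x)).
Qed.

Lemma wr_AX4_2 t (i : 'I_(card (wY Z t))) s (k : 'I_(card (wY (wr_fib2 g i) s))) :
  wr_fib2 (wr_ind2 i) k =
  wr_fib2 f (fin_incl (fib_card (wPhi (fin_fibP (fib_card (wphi g) t) s)) i) k).
Proof.
apply: wr_ob_eq => /=; first exact: AX4.
  move=> x y xy; apply: etrans (AX4 (wr_cmp_Phi e _ _ _) k) _.
  apply: fib_congr => //.
  by apply: wPhi_arr => //; apply: fib_incl.
exact: pi_fib_id.
Qed.

Lemma wr_AX4 q (j : 'I_(wr_card (wr_fib g q))) :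
  wr_fib (wr_ind q) j = wr_fib f (fin_incl (wr_fib_card g q) j).
Proof.
rewrite wr_incl_fib; have [s [k ->]] := wr_pairP j.
rewrite wr_incl_pair !wr_fib_pair; exact: wr_AX4_2.
Qed.
End WrInd.

Lemma wr_ind_id V Z (g : wr_hom V Z) (e : g = wr_cmp g (wr_id V)) q :
  wr_ind e q = wr_id (wr_fib g q).
Proof.
rewrite /wr_ind /wr_fib; move: (wr_snd q); move: (wr_fst q) => t i {q}.
apply: wr_hom_eq => [|s s' es es']; first exact: ind_id.
apply: arr_inj; apply: (etrans _ (esym (wr_id_Phi (W := wr_fib2 g i) es'))).
have ss' := wr_id_eq es'; move: es {es'}; case: _ / ss' => es; rewrite /=.
rewrite /wr_ind1; move: (wr_cmp_Phi _ _ _ _).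
have := wr_id_Phi (wr_ind_incl es); move: (wPhi (wr_ind_incl es)) => u eu.
rewrite (arr_inj eu) => E.
by rewrite ind_id.
Qed.

Lemma wr_ind_cmp W V Q Z (f : wr_hom W V) (a : wr_hom V Q) (c : wr_hom Q Z)
    (b : wr_hom W Q) (g : wr_hom V Z) (h : wr_hom W Z)
    (eb : b = wr_cmp a f) (eg : g = wr_cmp c a) (eh : h = wr_cmp c b)
    (eh' : h = wr_cmp g f) q :
    wr_ind eh q = wr_cmp (wr_ind eg q) (wr_ind eh' q).
Proof.
rewrite /wr_ind /wr_fib; move: (wr_snd q); move: (wr_fst q) => t i {q}.
apply: wr_hom_eq => [|s s' es es'].
  exact: ind_cmp (wr_map_cmp eb) _ _ _ _.
have es2 : cmap (wphi (wr_ind2 eg i)) (cmap (wphi (wr_ind2 eh' i)) s) = s'.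
  by rewrite -es' [RHS]cmap_cmp.
rewrite (wr_cmp_Phi erefl erefl es2 es') /= /wr_ind1.
apply: ind_cmp; apply: wr_cmp_Phi; exact: eb.
Qed.

Definition wr_U (c : pi0 O * pi0 R) : wr_ob :=
  @WrOb (U c.1) (fun=> U c.2) c.2 (fun=> pi_U c.2).
Definition wr_pi W := (pi (wX W), wd W).

Lemma wr_pi_U c : wr_pi (wr_U c) = c.
Proof. by case: c => c d; rewrite /wr_pi /= pi_U. Qed.

Lemma wr_cmap_id W p : wr_cmap (wr_id W) p = p.
Proof.
have [i [x ->]] := wr_pairP p.
rewrite (wr_cmap_pair (f := wr_id W) x (cmap_id i)); apply: wr_pair_eq => //.
transitivity (nat_of_ord (cmap (idm (wY W i)) x)); last by rewrite cmap_id.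
by apply: cmap_arr => //; apply: wr_id_Phi.
Qed.

Lemma wr_cmap_cmp W V Z (f : wr_hom W V) (g : wr_hom V Z) p :
  wr_cmap (wr_cmp g f) p = wr_cmap g (wr_cmap f p).
Proof.
have [i [x ->]] := wr_pairP p.
rewrite (wr_cmap_pair (f := f) x erefl) (wr_cmap_pair (f := g) _ erefl).
rewrite (wr_cmap_pair (f := wr_cmp g f) x (cmap_cmp (wphi f) (wphi g) i)).
by rewrite (wr_cmp_Phi erefl erefl erefl) cmap_cmp.
Qed.

Lemma wr_hom_pi W V : wr_hom W V -> wr_pi W = wr_pi V.
Proof. by move=> f; congr pair; [exact: pi_hom (wphi f) | exact: wd_eq f]. Qed.

Lemma wr_terminal W c : wr_pi W = c ->
  exists f : wr_hom W (wr_U c), forall g, g = f.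
Proof.
case: c => c d [ec ed].
exists (@WrHom W (wr_U (c, d)) (bang ec)
  (fun i j _ => bang (etrans (wdP i) ed)) ed) => g.
by apply: wr_hom_eq => [|i j e e'] /=; apply: U_hom_uniq.
Qed.

Lemma wr_AX1 c : wr_card (wr_U c) = 1.
Proof.
rewrite /wr_card (eq_bigr (fun=> 1)) => [|i _]; last by rewrite AX1.
by rewrite sum1_card card_ord AX1.
Qed.

Lemma wr_AX2 W q : exists c, wr_fib (wr_id W) q = wr_U c.
Proof.
rewrite /wr_fib; move: (wr_snd q); move: (wr_fst q) => t i {q}.
exists (pi (fib (idm (wX W)) t), pi (fib (idm (wY W t)) i)).
apply: wr_ob_eq => //=; first exact: fib_id_U.
move=> s _ _; rewrite -fib_id_U.
have st := wr_id_eq (fin_fibP (fib_card (idm (wX W)) t) s).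
move: (wr_id_eq _); rewrite st => e.
by rewrite (Prop_irrelevance e erefl).
Qed.

Lemma incl_U (K : OpCat) T c (f : @Hom K T (U c)) i x :
  fin_incl (fib_card f i) x = x :> nat.
Proof.
by apply: fin_incl_setT; apply/setP => y; rewrite !inE; apply/eqP/U_ord.
Qed.

Lemma wr_AX3a_ob W c (f : wr_hom W (wr_U c)) q : wr_fib f q = W.
Proof.
rewrite /wr_fib; move: (wr_snd q); move: (wr_fst q) => t i {q}.
apply: wr_ob_eq => /=; first exact: AX3a_ob.
  move=> s s' ss'; rewrite AX3a_ob; congr (wY W _); apply: val_inj.
  exact: etrans (@incl_U O _ c.1 (wphi f) _ _) ss'.
by rewrite AX3a_ob pi_U (wd_eq f).
Qed.

Lemma wr_AX3a_hom W V c (f : wr_hom W V) (g : wr_hom V (wr_U c))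
  (h : wr_hom W (wr_U c)) (e : h = wr_cmp g f) q : arr (wr_ind e q) = arr f.
Proof.
have eW := wr_AX3a_ob h q; have eV := wr_AX3a_ob g q.
apply: wr_arr_eq => //; first exact: AX3a_hom.
move=> i j eij i' j' eij' ii' jj'; rewrite /= AX3a_hom.
apply: wPhi_arr; apply: val_inj.
  exact: etrans (@incl_U O _ c.1 (wphi h) _ _) ii'.
exact: etrans (@incl_U O _ c.1 (wphi g) _ _) jj'.
Qed.

Lemma wr_AX5 W V Q Z (f : wr_hom W V) (a : wr_hom V Q) (c : wr_hom Q Z)
    (b : wr_hom W Q) (g : wr_hom V Z) (h : wr_hom W Z)
    (eb : b = wr_cmp a f) (eg : g = wr_cmp c a) (eh : h = wr_cmp c b)
    (eh' : h = wr_cmp g f) q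
    (ei : wr_ind eh q = wr_cmp (wr_ind eg q) (wr_ind eh' q))
    (j : 'I_(wr_card (wr_fib c q))) :
    arr (wr_ind ei j) = arr (wr_ind eb (fin_incl (wr_fib_card c q) j)).
Proof.
rewrite wr_incl_fib; move: ei j; rewrite /wr_ind /wr_fib.
move: (wr_snd q); move: (wr_fst q) => t i ei j {q}.
have [s [k ->]] := wr_pairP j.
rewrite wr_incl_pair !wr_ind_pair.
apply: wr_arr_eq; [exact: wr_AX4_2 | exact: wr_AX4_2 | exact: AX5 |].
move=> p p' ep r r' er pr pr'.
pose e2 := wr_ind_incl (fin_fibP (fib_card (ind (wr_map_cmp eg) t) s) p').
pose e3 := wr_ind_incl (fin_fibP (fib_card (ind (wr_map_cmp eh) t) s) p).
pose e1 := wr_ind_incl (wr_ind_incl ep).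
apply: (@etrans _ _ (arr (wr_ind1 eb e1 e2 e3
  (fin_incl (fib_card (wPhi (fin_fibP (fib_card (wphi c) t) s)) i) k)))).
  exact: (AX5 (wr_cmp_Phi eb e1 e2 e3)).
apply: wr_ind1_arr => //.
- exact: fib_incl.
- exact: fib_incl.
Qed.

Definition wreath : OpCat := {|
  Ob := wr_ob; Hom := wr_hom; idm := wr_id; cmp := wr_cmp;
  cmp_idl := wr_idl; cmp_idr := wr_idr; cmpA := wr_cmpA;
  pi0 := (pi0 O * pi0 R)%type; pi := wr_pi;
  piP := connected_of_terminal wr_hom_pi wr_terminal;
  U := wr_U; pi_U := wr_pi_U; U_terminal := wr_terminal;
  card := wr_card; cmap := wr_cmap;
  cmap_id := wr_cmap_id; cmap_cmp := wr_cmap_cmp;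
  fib := wr_fib; fib_card := wr_fib_card;
  AX1 := wr_AX1; AX2 := wr_AX2;
  ind := wr_ind; ind_cmap := wr_ind_cmap;
  ind_id := wr_ind_id; ind_cmp := wr_ind_cmp;
  AX3a_ob := wr_AX3a_ob; AX3a_hom := wr_AX3a_hom;
  AX4 := wr_AX4; AX5 := wr_AX5 |}.
End Wreath.

Section Quotient.
Local Open Scope quotient_scope.
Variables (O : OpCat) (D : OpData O) (E : forall T, D T -> D T -> Prop).
Hypotheses (Econg : op_congruence E) (Elaws : op_laws E).

Lemma q_equiv T : equivalence (D T) (@E T).
Proof. by case: Econg. Qed.

Lemma q_refl T : reflexive (fun a b : {classic D T} => `[< @E T a b >]).
Proof. by move=> a; apply/asboolP; case: (q_equiv T) => r _ _; apply: r. Qed.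

Lemma q_sym T : symmetric (fun a b : {classic D T} => `[< @E T a b >]).
Proof.
case: (q_equiv T) => _ _ s a b.
by apply/asboolP/asboolP => ?; apply: s.
Qed.

Lemma q_trans T : transitive (fun a b : {classic D T} => `[< @E T a b >]).
Proof.
case: (q_equiv T) => _ t _ a b c /asboolP ba /asboolP ac; apply/asboolP.
exact: t ba ac.
Qed.

Definition q_rel T : equiv_rel {classic D T} :=
  EquivRel _ (@q_refl T) (@q_sym T) (@q_trans T).
Definition q_car T : Type := {eq_quot q_rel T}.
Definition q_pi T (x : D T) : q_car T := \pi_({eq_quot q_rel T}) (x : {classic D T}).
Definition q_repr T (q : q_car T) : D T := repr (q : {eq_quot q_rel T}).

Lemma q_reprK T (q : q_car T) : q_pi (q_repr q) = q.
Proof. exact: reprK. Qed.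

Lemma q_piP T (x y : D T) : q_pi x = q_pi y <-> E x y.
Proof.
by split=> [/eqquotP/asboolP|h]; last by apply/eqquotP/asboolP.
Qed.

Lemma q_repr_pi T (x : D T) : E (q_repr (q_pi x)) x.
Proof. by apply/q_piP; rewrite q_reprK. Qed.

Lemma q_reprP T (q : q_car T) (x : D T) : q = q_pi x <-> E (q_repr q) x.
Proof. by rewrite -q_piP q_reprK. Qed.

Lemma E_eq T (x y : D T) : x = y -> E x y.
Proof. by move=> ->; case: (q_equiv T) => r _ _; apply: r. Qed.

Definition q_data : OpData O := {|
  op_car := q_car;
  op_unit := fun c => q_pi (op_unit D c);
  op_mu := fun T S f x y => q_pi (op_mu f (fun i => q_repr (x i)) (q_repr y)) |}.

Lemma q_mu_pi T S (f : Hom T S) (x : forall i, D (fib f i)) (y : D S) :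
  @op_mu O q_data T S f (fun i => q_pi (x i)) (q_pi y) = q_pi (op_mu f x y).
Proof.
apply/q_piP; case: Econg => _; apply; last exact: q_repr_pi.
by move=> i; apply: q_repr_pi.
Qed.

Lemma q_tr_pi T S (e : T = S) (x : D T) :
  tr (P := q_car) e (q_pi x) = q_pi (tr (P := D) e x).
Proof. by case: _ / e. Qed.

Lemma q_fam T S (f : Hom T S) (x : forall i, q_car (fib f i)) :
  exists x' : forall i, D (fib f i), x = (fun i => q_pi (x' i)).
Proof.
exists (fun i => q_repr (x i)); apply: functional_extensionality_dep => i.
by rewrite q_reprK.
Qed.

Lemma q_laws : op_laws (D := q_data) (fun T => @eq (q_data T)).
Proof.
case: Elaws => EA El Er; split.
- move=> T S R f g h e x y z.
  have [x' ->] := q_fam x; have [y' ->] := q_fam y; rewrite -(q_reprK z).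
  rewrite !q_mu_pi; move/q_piP: (EA T S R f g h e x' y' (q_repr z)) => ->.
  rewrite /mu_assoc -q_mu_pi; congr op_mu.
  apply: functional_extensionality_dep => i; rewrite -q_mu_pi; congr op_mu.
  by apply: functional_extensionality_dep => j; rewrite -q_tr_pi.
- move=> T x; rewrite -[in RHS](q_reprK x).
  move/q_piP: (El T (q_repr x)) => <-; rewrite -q_mu_pi q_reprK; congr op_mu.
  by apply: functional_extensionality_dep => i; rewrite /id_units -q_tr_pi.
- move=> T c f x; rewrite -[in RHS](q_reprK x).
  move/q_piP: (Er T c f (q_repr x)) => <-; rewrite -q_mu_pi; congr op_mu.
  by apply: functional_extensionality_dep => i; rewrite /over_U -q_tr_pi q_reprK.
Qed.

Definition quot_operad : Operad O := {| op_lawsP := q_laws |}.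
End Quotient.

(* Operadic terms in generators G.  The operad presented by G and R is the
   quotient of the terms by the smallest congruence that contains R and
   satisfies the operad laws: the free operad on G modulo the operadic
   congruence generated by R. *)
Section Presentation.
Variables (O : OpCat) (G : Ob O -> Type).

Inductive term : Ob O -> Type :=
| gen T of G T : term T
| tunit c : term (U c)
| tmu T S (f : Hom T S) of (forall i, term (fib f i)) & term S : term T.

Definition term_data : OpData O :=
  {| op_car := term; op_unit := tunit; op_mu := tmu |}.

Variable R : forall T, term T -> term T -> Prop.

Definition pres_eq T (a b : term T) : Prop :=
  forall E : forall T, term_data T -> term_data T -> Prop,
  op_congruence E -> op_laws E -> (forall T a b, R a b -> E T a b) -> E T a b.

Lemma pres_congruence : op_congruence (D := term_data) pres_eq.
Proof.
split=> [T|T S f x x' y y' xx yy E Ec El ER]; last first.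
  case: (Ec) => _; apply; first by move=> i; apply: xx.
  exact: yy.
split=> [a|a b c ab bc|a b ab] E Ec El ER; have [r t s] := (let: conj e _ := Ec in e T).
- exact: r.
- exact: t (ab E Ec El ER) (bc E Ec El ER).
- exact: s (ab E Ec El ER).
Qed.

Lemma pres_laws : op_laws (D := term_data) pres_eq.
Proof.
split=> [T S Q f g h e x y z|T x|T c f x] E Ec El ER; case: (El) => EA Eu Ev.
- exact: EA.
- exact: Eu.
- exact: Ev.
Qed.

Definition presented : Operad O := quot_operad pres_congruence pres_laws.
End Presentation.
Arguments gen {O G T} _.

(* Bq is functorial in the set of colours. *)
Section ColourChange.
Variables (C D : Type) (phi : C -> D).

Definition bq_ob (T : bouquet C) : bouquet D :=
  @Bouquet D (bar T) (fun i => phi (bcol T i)) (phi (broot T)).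
Definition bq_hom (T S : bouquet C) (f : bqmap T S) : bqmap (bq_ob T) (bq_ob S) :=
  @Bqmap D (bq_ob T) (bq_ob S) (bfun f) (f_equal phi (bqmap_root f)).

Lemma bq_hom_cmp (T S R : bouquet C) (f : bqmap T S) (g : bqmap S R)
  (h : bqmap T R) : h = bq_cmp g f -> bq_hom h = bq_cmp (bq_hom g) (bq_hom f).
Proof. by move=> ->; apply: bqmap_eq. Qed.

Variable Q : Operad (Bq D).

Definition pull_data : OpData (Bq C) := {|
  op_car := fun T : Ob (Bq C) => Q (bq_ob T);
  op_unit := fun c => op_unit Q (phi c);
  op_mu := fun T S (f : @Hom (Bq C) T S) x y =>
    @op_mu (Bq D) Q (bq_ob T) (bq_ob S) (bq_hom f) x y |}.

Lemma pk_pull (T S : bouquet C) (x : Q (bq_ob T)) (y : Q (bq_ob S)) :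
  @pk _ pull_data T x = @pk _ pull_data S y -> @pk _ Q _ x = @pk _ Q _ y.
Proof.
exact: (f_equal (fun u : {T : bouquet C & Q (bq_ob T)} => @pk _ Q _ (projT2 u))).
Qed.

Lemma pull_laws : op_laws (D := pull_data) (fun T => @eq (pull_data T)).
Proof.
split.
- move=> T S R f g h e x y z.
  rewrite [LHS](op_assoc (P := Q) (f := bq_hom f) (g := bq_hom g) (bq_hom_cmp e)).
  rewrite /mu_assoc; congr op_mu; apply: functional_extensionality_dep => i.
  apply: (@pk_inj _ Q); apply: mu_congr => //.
    congr (arr _); apply: bqmap_eq => k; apply: enum_val_inj.
    by rewrite [LHS]bq_indE [RHS]bq_indE.
  move=> j j' /val_inj <-; rewrite pk_tr; symmetry.
  exact: pk_pull (pk_tr (P := pull_data) (esym (AX4 e j)) (x _)).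
- move=> T x; apply: (pk_unitl (P := Q)); first exact: bqmap_eq.
  move=> i; exists (phi (broot (fib (o := Bq C) (idm (o := Bq C) T) i))).
  exact: pk_pull (pk_tr (P := pull_data) (esym (@fib_id_U (Bq C) T i))
    (op_unit pull_data _)).
- move=> T c f x; apply: (pk_unitr (P := Q) (c := phi c)) => // i.
  exact: pk_pull (pk_tr (P := pull_data) (esym (@AX3a_ob (Bq C) T c f i)) x).
Qed.

Definition pull : Operad (Bq C) := {| op_lawsP := pull_laws |}.
End ColourChange.

Record SOp := { scolours : Type; sop :> Operad (Bq scolours) }.

(* An operadic functor Bq(C) -> Bq(D) is given by a map C -> D. *)
Record SOpHom (X Y : SOp) := {
  scol : scolours X -> scolours Y;
  smor : OpHom X (pull scol Y)
}.

Section SOpCategory.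
Implicit Types X Y Z : SOp.

Lemma sop_id_mu X T S (f : @Hom (Bq (scolours X)) T S)
  (x : forall i, X (fib f i)) (y : X S) :
  op_mu f x y = @op_mu (Bq (scolours X)) (pull id X) T S f x y.
Proof.
apply: (@pk_inj _ X); apply: mu_congr => //; last by move=> i i' /val_inj ->.
by congr (arr _); apply: (@bqmap_eq _ T S).
Qed.

Definition sop_id X : SOpHom X X := {|
  scol := id;
  smor := @Build_OpHom _ X (pull id X) (fun T x => x) (fun=> erefl)
            (@sop_id_mu X) |}.

Section Comp.
Variables (X Y Z : SOp) (g : SOpHom Y Z) (f : SOpHom X Y).

Definition sop_cmp_fun T (x : X T) : pull (fun c => scol g (scol f c)) Z T :=
  op_fun (smor g) (op_fun (smor f) x).

Lemma sop_cmp_unit c : sop_cmp_fun (op_unit X c) = op_unit (pull _ Z) c.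
Proof.
rewrite /sop_cmp_fun (op_fun_unit (smor f) c).
exact: op_fun_unit (smor g) (scol f c).
Qed.

Lemma sop_cmp_mu T S (h : @Hom (Bq (scolours X)) T S)
  (x : forall i, X (fib h i)) (y : X S) :
  sop_cmp_fun (op_mu h x y) =
  @op_mu _ (pull (fun c => scol g (scol f c)) Z) T S h
    (fun i => sop_cmp_fun (x i)) (sop_cmp_fun y).
Proof.
rewrite /sop_cmp_fun (op_fun_mu (smor f) x y).
rewrite [LHS](op_fun_mu (smor g) (f := bq_hom (scol f) h)).
apply: (@pk_inj _ Z); apply: mu_congr => //.
  by congr (arr _); apply: bqmap_eq.
by move=> i i' /val_inj ->.
Qed.

Definition sop_cmp : SOpHom X Z := {|
  scol := fun c => scol g (scol f c);
  smor := @Build_OpHom _ X (pull _ Z) sop_cmp_fun sop_cmp_unit sop_cmp_mu |}.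
End Comp.

Definition sop_iso X Y : Prop := exists (f : SOpHom X Y) (g : SOpHom Y X),
  sop_cmp g f = sop_id X /\ sop_cmp f g = sop_id Y.
End SOpCategory.

Section Arity.
Variable O : OpCat.

Definition Ar (T : Ob O) : bouquet (pi0 O) :=
  @Bouquet (pi0 O) (card T) (fun i => pi (fib (idm T) i)) (pi T).

Definition Ar_hom (T S : Ob O) (f : Hom T S) : bqmap (Ar T) (Ar S) :=
  @Bqmap (pi0 O) (Ar T) (Ar S) (cmap f) (pi_hom f).

Lemma Ar_fib (T S : Ob O) (f : Hom T S) i :
  Ar (fib f i) = fib (o := Bq (pi0 O)) (Ar_hom f) i.
Proof.
apply: bouquet_eq => /=; [exact: fib_card | exact: pi_fib |].
move=> x y xy; rewrite pi_fib_id; congr (pi (fib _ _)).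
rewrite -(fin_incl_id erefl y); rewrite /fin_incl; congr enum_val.
exact: val_inj.
Qed.

Lemma Ar_U (c : pi0 O) : U (o := Bq (pi0 O)) c = Ar (U (o := O) c).
Proof.
apply: bouquet_eq => /=; rewrite ?AX1 ?pi_U // => x y _.
by rewrite AX3a_ob pi_U.
Qed.

Inductive A_gen : bouquet (pi0 O) -> Type := A_ob T : A_gen (Ar T).

Definition A_term := @term (Bq (pi0 O)) A_gen.
Definition A_class (T : Ob O) : A_term (Ar T) :=
  gen (O := Bq (pi0 O)) (A_ob T).

Inductive A_rel : forall T, A_term T -> A_term T -> Prop :=
| A_rel_unit (c : pi0 O) : A_rel (A_class (U (o := O) c))
    (tr (P := A_term) (Ar_U c) (@tunit (Bq (pi0 O)) _ c))
| A_rel_mu T S (f : Hom T S) : A_rel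
    (@tmu (Bq (pi0 O)) _ (Ar T) (Ar S) (Ar_hom f)
      (fun i => tr (P := A_term) (Ar_fib f i) (A_class (fib f i)))
      (A_class S))
    (A_class T).

(* The value of the functor A on an operadic category; the symmetric operad it
   presents has pi0 O as its set of colours. *)
Definition Aop : SOp := {| sop := presented A_rel |}.
End Arity.

Section Symmetric.
Variable C : Type.
Implicit Types T S : bouquet C.

Section Concat.
Variables (T : bouquet C) (Ts : 'I_(bar T) -> bouquet C).

Definition concat : bouquet C :=
  @Bouquet C (\sum_i bar (Ts i))
    (fun p => bcol (Ts (tagnat.sig1 p)) (tagnat.sig2 p)) (broot T).

Definition concat_nu : bqmap concat T :=
  @Bqmap C concat T (fun p => tagnat.sig1 p) erefl.

Lemma concat_col i (y : 'I_(bar (Ts i))) :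
  bcol concat (@tagnat.Rank _ (fun i => bar (Ts i)) i y) = bcol (Ts i) y.
Proof. by rewrite /= /tagnat.sig1 /tagnat.sig2 /tagnat.Rank tagnat.rankK. Qed.

Lemma concat_img i (p : 'I_(bar concat)) : (p \in fin_fib concat_nu i) <->
  exists y, @tagnat.Rank _ (fun i => bar (Ts i)) i y = p.
Proof.
rewrite inE /=; split=> [/eqP <-|[y <-]]; last by rewrite tagnat.Rank1K.
by exists (tagnat.sig2 p); rewrite tagnat.sig2K.
Qed.

Lemma concat_mono i (x y : 'I_(bar (Ts i))) : x < y ->
  @tagnat.Rank _ (fun i => bar (Ts i)) i x <
  @tagnat.Rank _ (fun i => bar (Ts i)) i y.
Proof.
by move=> xy; have := @tagnat.lt_Rank _ (fun i => bar (Ts i)) i x y;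
  rewrite !ltEord => ->.
Qed.

Lemma concat_fib i : broot (Ts i) = bcol T i ->
  Ts i = fib (o := Bq C) concat_nu i.
Proof.
move=> er; have ec := fin_card_unique (@concat_mono i) (concat_img i).
apply: bouquet_eq => //= x y xy.
have -> : enum_val y = fin_incl ec x.
  by rewrite /fin_incl; congr enum_val; apply: val_inj.
rewrite (fin_incl_unique (@concat_mono i) (concat_img i)).
by rewrite -/(bcol concat _) concat_col.
Qed.
End Concat.

Lemma perm_fib T S (p : bqmap T S) y : bijective p ->
  (forall x, bcol S (p x) = bcol T x) ->
  U (o := Bq C) (bcol S y) = fib (o := Bq C) p y.
Proof.
move=> [q pq qp] pc; apply: bouquet_eq => //=.
  have -> : fin_fib p y = [set q y]; last by rewrite cards1.
  by apply/setP => x; rewrite !inE (can2_eq pq qp).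
move=> _ x _; rewrite -pc; congr bcol.
by have := enum_valP x; rewrite inE => /eqP.
Qed.

Variable D : OpData (Bq C).

(* gamma(x; x_1, ..., x_n) = mu^nu((x_1, ..., x_n), x). *)
Definition gamma T (Ts : 'I_(bar T) -> bouquet C)
  (e : forall i, broot (Ts i) = bcol T i) (x : D T) (xs : forall i, D (Ts i)) :
  D (concat Ts) :=
  @op_mu (Bq C) D (concat Ts) T (concat_nu Ts)
    (fun i => tr (P := D) (concat_fib (e i)) (xs i)) x.

(* x . p = mu^p((u, ..., u), x); p : T -> S is a bijection respecting colours,
   so the result has arity T when x has arity S. *)
Definition sym_act T S (p : bqmap T S) (pb : bijective p)
  (pc : forall x, bcol S (p x) = bcol T x) (x : D S) : D T :=
  @op_mu (Bq C) D T S p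
    (fun y => tr (P := D) (perm_fib y pb pc) (op_unit D (bcol S y))) x.
End Symmetric.

Section BoardmanVogt.
Variables (C D : Type) (P : Operad (Bq C)) (Q : Operad (Bq D)).
Implicit Types (T : bouquet C) (S : bouquet D).

Definition bv_obl T d : bouquet (C * D) := bq_ob (fun c => (c, d)) T.
Definition bv_obr c S : bouquet (C * D) := bq_ob (fun d => (c, d)) S.

Inductive bv_gen : bouquet (C * D) -> Type :=
| bv_genl T (x : P T) d : bv_gen (bv_obl T d)
| bv_genr c S (y : Q S) : bv_gen (bv_obr c S).

Definition bv_term := @term (Bq (C * D)) bv_gen.
Definition bv_data : OpData (Bq (C * D)) := @term_data (Bq (C * D)) bv_gen.
Definition bv_l T (x : P T) d : bv_term (bv_obl T d) :=
  gen (O := Bq (C * D)) (bv_genl x d).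
Definition bv_r c S (y : Q S) : bv_term (bv_obr c S) :=
  gen (O := Bq (C * D)) (bv_genr c y).

(* The inputs (c_i, d_j), in lexicographic and reverse-lexicographic order. *)
Definition bv_lex T S : bouquet (C * D) :=
  @concat _ (bv_obl T (broot S)) (fun i => bv_obr (bcol T i) S).
Definition bv_rlex T S : bouquet (C * D) :=
  @concat _ (bv_obr (broot T) S) (fun j => bv_obl T (bcol S j)).

Definition shuffle T S : bqmap (bv_lex T S) (bv_rlex T S) :=
  @Bqmap _ (bv_lex T S) (bv_rlex T S)
    (fun p => @tagnat.Rank (bar S) (fun=> bar T) (tagnat.sig2 p) (tagnat.sig1 p))
    erefl.

Lemma shuffle_bij T S : bijective (shuffle T S).
Proof.
pose swap m n (p : 'I_(\sum_(i < m) n)) : 'I_(\sum_(j < n) m) :=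
  @tagnat.Rank n (fun=> m) (tagnat.sig2 p) (tagnat.sig1 p).
have swapK m n : cancel (@swap m n) (@swap n m).
  move=> p; rewrite /swap -[RHS]tagnat.sig2K; apply: val_inj; apply/eqP.
  rewrite /= tagnat.eq_Rank tagnat.Rank1K eqxx andbT; apply/eqP.
  apply: val_inj; rewrite tagnat.Rank2K; exact: erefl.
by exists (@swap (bar S) (bar T)); apply: swapK.
Qed.

Lemma shuffle_col T S p : bcol (bv_rlex T S) (shuffle T S p) = bcol (bv_lex T S) p.
Proof. by 
exact: (@concat_col _ (bv_obr (broot T) S) (fun j => bv_obl T (bcol S j))). Qed.

(* By the identification of operads over Bq with symmetric operads, the first
   four relations express compatibility of - (x) d and c (x) - with units,
   compositions and symmetric group actions. *)
Inductive bv_rel : forall B, bv_term B -> bv_term B -> Prop :=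
| bv_rel_unitl c d :
    bv_rel (bv_l (op_unit P c) d) (@tunit (Bq (C * D)) _ (c, d))
| bv_rel_mul T T' (f : @Hom (Bq C) T T') (x : forall i, P (fib f i)) (y : P T') d :
    bv_rel (bv_l (op_mu f x y) d)
      (@tmu (Bq (C * D)) _ (bv_obl T d) (bv_obl T' d) (bq_hom _ f)
        (fun i => bv_l (x i) d) (bv_l y d))
| bv_rel_unitr c d :
    bv_rel (bv_r c (op_unit Q d)) (@tunit (Bq (C * D)) _ (c, d))
| bv_rel_mur c S S' (f : @Hom (Bq D) S S') (x : forall i, Q (fib f i)) (y : Q S') :
    bv_rel (bv_r c (op_mu f x y))
      (@tmu (Bq (C * D)) _ (bv_obr c S) (bv_obr c S') (bq_hom _ f)
        (fun i => bv_r c (x i)) (bv_r c y))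
| bv_rel_interchange T S (x : P T) (y : Q S) :
    bv_rel
      (gamma (D := bv_data) (T := bv_obl T (broot S))
        (Ts := fun i => bv_obr (bcol T i) S) (fun=> erefl)
        (bv_l x (broot S)) (fun i => bv_r (bcol T i) y))
      (sym_act (D := bv_data) (shuffle_bij T S) (@shuffle_col T S)
        (gamma (D := bv_data) (T := bv_obr (broot T) S)
          (Ts := fun j => bv_obl T (bcol S j)) (fun=> erefl)
          (bv_r (broot T) y) (fun j => bv_l x (bcol S j)))).

Definition BV : SOp := {| sop := presented bv_rel |}.
End BoardmanVogt.

(* Main.v *)
Require Import Defs.
From mathcomp Require Import all_boot all_order.
From mathcomp Require Import boolp.

Set Implicit Arguments.
Unset Strict Implicit.
Unset Printing Implicit Defensive.

(* The two presented operads have the same colours.  In one direction x (x) d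
   goes to the class of (x; u_d, ..., u_d) and c (x) y to that of (u_c; y); in
   the other the class of (x; y_1, ..., y_n) goes to
   gamma(x (x) d; c_1 (x) y_1, ..., c_n (x) y_n).  The interchange relation holds
   in A because (x; y, ..., y) maps both to (x; u, ..., u) and to (u; y).
   Conversely, the relation of A given by a morphism with target (z; w_1, ..., w_m)
   splits by associativity into one statement for each w_t, and this follows from
   the interchange relation for w_t. *)

(** * Presented operads and fibres of maps of bouquets *)

Section HomTheory.
Variable O : OpCat.

Lemma op_hom_eq (P Q : Operad O) (f g : OpHom P Q) :
  (forall T x, op_fun f (T := T) x = op_fun g x) -> f = g.
Proof.
case: f => f fu fm; case: g => g gu gm /= fg.
have e : f = g.
  apply: functional_extensionality_dep => T.
  by apply: functional_extensionality_dep => x; apply: fg.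
by subst g; congr Build_OpHom; apply: Prop_irrelevance.
Qed.
End HomTheory.

Section UniversalProperty.
Variables (O : OpCat) (G : Ob O -> Type) (R : forall T, term G T -> term G T -> Prop).
Arguments R {T} _ _.

Definition pres_class T (t : term G T) : presented (@R) T :=
  q_pi (pres_congruence (@R)) t.

Lemma pres_class_tr T S (e : T = S) (t : term G T) :
  pres_class (tr (P := term G) e t) = tr (P := presented (@R)) e (pres_class t).
Proof. by case: _ / e. Qed.

Lemma pres_class_mu T S (f : Hom T S) (x : forall i, term G (fib f i)) (y : term G S) :
  pres_class (tmu x y) = op_mu f (fun i => pres_class (x i)) (pres_class y).
Proof. by rewrite [RHS]q_mu_pi. Qed.

Lemma pres_class_rel T (a b : term G T) : R a b -> pres_class a = pres_class b.
Proof. by move=> ab; apply/q_piP => E Ec El ER; apply: ER. Qed.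

Section Lift.
Variables (N : Operad O) (phi : forall T, G T -> N T).

Fixpoint eval T (t : term G T) : N T :=
  match t with
  | gen _ g => phi g
  | tunit c => op_unit N c
  | tmu _ _ f x y => op_mu f (fun i => eval (x i)) (eval y)
  end.

Lemma eval_tr T S (e : T = S) (t : term G T) :
  eval (tr (P := term G) e t) = tr (P := N) e (eval t).
Proof. by case: _ / e. Qed.

Hypothesis phiR : forall T (a b : term G T), R a b -> eval a = eval b.

(** [pres_eq] is contained in every congruence that satisfies the operad laws and contains [R]; by
    the laws of [N] and [phiR], the kernel of [eval] is one of them. *)
Lemma eval_pres_eq T (a b : term G T) : pres_eq (@R) a b -> eval a = eval b.
Proof.
move=> H; apply: (H (fun T a b => eval a = eval b)) => //.
- split=> [S|S S' f x x' y y' /= xx ->].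
    by split=> [x|x y z -> //|x y ->].
  by congr op_mu; apply: functional_extensionality_dep => i; apply: xx.
- split=> [T1 T2 T3 f g h e x y z|S x|S c f x] /=.
  + rewrite (op_assoc e) /mu_assoc; congr op_mu.
    apply: functional_extensionality_dep => i; congr op_mu.
    by apply: functional_extensionality_dep => j; rewrite eval_tr.
  + rewrite -[RHS]op_unitl; congr op_mu.
    by apply: functional_extensionality_dep => i; rewrite eval_tr.
  + rewrite -[RHS](op_unitr f); congr op_mu.
    by apply: functional_extensionality_dep => i; rewrite eval_tr.
Qed.

Definition pres_lift_fun T (q : presented (@R) T) : N T := eval (q_repr q).

Lemma pres_liftE T (t : term G T) : pres_lift_fun (pres_class t) = eval t.
Proof. apply: eval_pres_eq; exact: q_repr_pi. Qed.

Lemma pres_lift_unit c :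
  pres_lift_fun (op_unit (presented (@R)) c) = op_unit N c.
Proof. exact: pres_liftE (@tunit O G c). Qed.

Lemma pres_lift_mu T S (f : Hom T S) (x : forall i, presented (@R) (fib f i))
  (y : presented (@R) S) :
  pres_lift_fun (op_mu f x y) =
  op_mu f (fun i => pres_lift_fun (x i)) (pres_lift_fun y).
Proof. exact: pres_liftE (tmu (fun i => q_repr (x i)) (q_repr y)). Qed.

Definition pres_lift : OpHom (presented (@R)) N :=
  {| op_fun_unit := pres_lift_unit; op_fun_mu := pres_lift_mu |}.
End Lift.

(** Uniqueness half of the universal property, by induction on a representing term. [Q] is a bare
    family, so that a composite of two morphisms fits without being packaged as a morphism. *)
Lemma pres_ext T0 (Q : forall T, presented (@R) T -> presented (@R) T)
  (Qu : forall c, Q _ (op_unit _ c) = op_unit _ c)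
  (Qm : forall T S (f : Hom T S) x y,
     Q T (op_mu f x y) = op_mu f (fun i => Q _ (x i)) (Q S y))
  (Qg : forall T (g : G T), Q T (pres_class (gen g)) = pres_class (gen g))
  (x : presented (@R) T0) : Q T0 x = x.
Proof.
rewrite -(q_reprK x); elim: (q_repr x) => {T0 x} [T g|c|T S f x IHx y IHy].
- exact: Qg.
- exact: Qu.
rewrite [q_pi _ _]pres_class_mu Qm; congr op_mu; last exact: IHy.
by apply: functional_extensionality_dep => i; apply: IHx.
Qed.
End UniversalProperty.

Section Fibres.
Variables C : Type.
Implicit Types T S R B : bouquet C.

(* Describing fibres by explicit increasing embeddings avoids computing with the
   enumerations in bq_fib and bq_ind. *)
Record isfib T S (f : bqmap T S) i B (u : 'I_(bar B) -> 'I_(bar T)) : Prop := IsFib {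
  isfib_mono : forall p q : 'I_(bar B), p < q -> u p < u q;
  isfib_img : forall p, f p = i <-> exists q, u q = p;
  isfib_col : forall q, bcol B q = bcol T (u q);
  isfib_root : broot B = bcol S i
}.

Section IsFib.
Variables (T S : bouquet C) (f : bqmap T S) (i : 'I_(bar S)) (B : bouquet C).
Variable u : 'I_(bar B) -> 'I_(bar T).
Hypothesis uP : isfib f i u.

Lemma isfib_map q : f (u q) = i.
Proof. by apply/(isfib_img uP); exists q. Qed.

Lemma isfib_mem p : (p \in fin_fib f i) <-> exists q, u q = p.
Proof. by rewrite inE; split=> [/eqP/(isfib_img uP)|/(isfib_img uP)/eqP]. Qed.

Lemma isfib_card : bar B = #|fin_fib f i|.
Proof. exact: fin_card_unique (isfib_mono uP) isfib_mem. Qed.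

(** An increasing map is determined by its image, so [u] must agree with the enumeration used in
    [bq_fib]. *)
Lemma isfib_val (p : 'I_(bar B)) (q : 'I_#|fin_fib f i|) : p = q :> nat ->
  enum_val q = u p.
Proof.
move=> pq; rewrite -(fin_incl_unique (isfib_mono uP) isfib_mem isfib_card p).
by rewrite /fin_incl; congr enum_val; apply: val_inj.
Qed.

Lemma isfib_eq : B = fib (o := Bq C) f i.
Proof.
apply: bouquet_eq => /=; first exact: isfib_card.
  exact: isfib_root uP.
by move=> x y xy; rewrite (isfib_col uP) (isfib_val xy).
Qed.
End IsFib.

Lemma isfib_self T S (f : bqmap T S) i :
  isfib (B := fib (o := Bq C) f i) f i (@enum_val _ (mem (fin_fib f i))).
Proof.
split=> //= [p q pq|p].
  by rewrite -!(fin_incl_id erefl); apply: fin_incl_mono.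
split=> [e|[q <-]]; last by have := enum_valP q; rewrite inE => /eqP.
have pP : p \in fin_fib f i by rewrite inE e.
by exists (enum_rank_in pP p); rewrite enum_rankK_in.
Qed.

Variable M : Operad (Bq C).

(** Associativity with the fibres made explicit: over each [i], the fibres of [h] and [g] are
    replaced by bouquets embedded by [u] and [v], and the induced map by any [k] with
    [v (k p) = f (u p)]. Elements are compared through [pk], since their arities agree only
    propositionally. *)
Lemma mu_fibs_assoc T S R (f : bqmap T S) (g : bqmap S R) (h : bqmap T R)
  (x : forall j, M (bq_fib f j)) (y : forall i, M (bq_fib g i)) (z : M R)
  (w : forall i, M (bq_fib h i)) :
  (forall p, h p = g (f p)) ->
  (forall i, exists B B' u v (k : bqmap B B')
      (x' : forall j, M (bq_fib k j)) (y' : M B'),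
    [/\ isfib h i u, isfib g i v, forall p, v (k p) = f (u p) &
     [/\ pk (w i) = pk (op_mu (o := M) k x' y'), pk (y i) = pk y' &
         forall j, pk (x (v j)) = pk (x' j)]]) ->
  @op_mu (Bq C) M T S f x (@op_mu (Bq C) M S R g y z) = @op_mu (Bq C) M T R h w z.
Proof.
move=> hgf H; have e : h = bq_cmp g f by apply: bqmap_eq => p; apply: hgf.
rewrite (op_assoc (P := M) (f := f) (g := g) e) /mu_assoc; congr op_mu.
apply: functional_extensionality_dep => i; apply: (@pk_inj _ M).
have [B [B' [u [v [k [x' [y' [uP vP kE [-> yy xx]]]]]]]]] := H i.
apply: mu_congr => //.
  apply: bqarr_eq; [exact: esym (isfib_eq uP) | exact: esym (isfib_eq vP) |].
  move=> p p' pp'; have E := bq_indE e p.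
  rewrite (isfib_val uP (esym pp')) -kE in E.
  have eB := f_equal (@bar _) (isfib_eq vP).
  (* The enumeration of the fibre of [g] is injective and agrees with [v]; under it both sides
     become [v (k p')]. *)
  suff -> : bq_ind e i p = cast_ord eB (k p') by [].
  by apply: enum_val_inj; rewrite E; symmetry; apply: isfib_val.
move=> j j' jj'; rewrite pk_tr -xx; have E := isfib_val vP (esym jj').
by rewrite -E fin_incl_id.
Qed.
End Fibres.

(** * Lexicographic sums *)

Section Ranks.
Variables (n : nat) (p_ : 'I_n -> nat).

Lemma rank_cases (p : 'I_(\sum_i p_ i)) : exists i x, p = @tagnat.Rank n p_ i x.
Proof. by exists (tagnat.sig1 p), (tagnat.sig2 p); rewrite tagnat.sig2K. Qed.

Lemma rank_lt i (x : 'I_(p_ i)) i' (x' : 'I_(p_ i')) :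
  (@tagnat.Rank n p_ i x < @tagnat.Rank n p_ i' x') =
  (i < i') || (i == i') && (x < x').
Proof.
have := @tagnat.lt_rank _ p_ (Tagged _ x) (Tagged _ x').
rewrite ltEsig /= ltEord => ->; rewrite !leEord !ltEord.
case: (ltngtP i i') => //= [ii'|/val_inj ii'].
  by case: eqP => // e; subst i'; rewrite ltnn in ii'.
by subst i'; rewrite eqxx tagged_asE.
Qed.

Lemma rank_eq i (x : 'I_(p_ i)) i' (x' : 'I_(p_ i')) : i = i' -> x = x' :> nat ->
  @tagnat.Rank n p_ i x = @tagnat.Rank n p_ i' x'.
Proof. by move=> ei; subst i' => /val_inj ->. Qed.

Lemma rank_inj2 i (x : 'I_(p_ i)) i' (x' : 'I_(p_ i')) :
  @tagnat.Rank n p_ i x = @tagnat.Rank n p_ i' x' ->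
  i = i' /\ x = x' :> nat.
Proof.
by move=> /eqP; rewrite -val_eqE /= tagnat.eq_Rank => /andP[/eqP ? /eqP ?].
Qed.

Lemma sig2_Rank i (x : 'I_(p_ i)) : tagnat.sig2 (@tagnat.Rank n p_ i x) = x :> nat.
Proof. by rewrite tagnat.Rank2K. Qed.
End Ranks.

Lemma concat_isfib C (T : bouquet C) (Ts : 'I_(bar T) -> bouquet C) i :
  broot (Ts i) = bcol T i ->
  isfib (concat_nu Ts) i (@tagnat.Rank _ (fun i => bar (Ts i)) i).
Proof.
move=> e; split=> // [p q|p|q]; first exact: concat_mono.
  by rewrite -concat_img inE; split=> /eqP.
by rewrite concat_col.
Qed.

Section Shuffle.
Variables (C D : Type) (T : bouquet C) (S : bouquet D).

Definition lex_snd : bqmap (bv_lex T S) (bv_obr (broot T) S) :=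
  @Bqmap _ (bv_lex T S) (bv_obr (broot T) S)
    (fun p => @tagnat.sig2 _ (fun=> bar S) p) erefl.

Lemma lex_snd_fib j : isfib (B := bv_obl T (bcol S j)) lex_snd j
  (fun s => @tagnat.Rank (bar T) (fun=> bar S) s j).
Proof.
split=> //= [p q pq|p|q]; first by rewrite rank_lt pq.
  split=> [<-|[q <-]]; first by exists (tagnat.sig1 p); rewrite tagnat.sig2K.
  by apply: val_inj; rewrite /= sig2_Rank.
exact: esym (@concat_col _ (bv_obl T (broot S)) (fun i => bv_obr (bcol T i) S) q j).
Qed.

Variables (M : Operad (Bq (C * D))) (a : forall j, M (bv_obl T (bcol S j))).
Variable b : M (bv_obr (broot T) S).

(** The shuffle followed by the projection of [bv_rlex] onto [S] is [lex_snd], so associativity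
    merges the two structure maps into one. *)
Lemma sym_act_shuffle_gamma :
  sym_act (D := M) (shuffle_bij T S) (@shuffle_col _ _ T S)
    (gamma (D := M) (T := bv_obr (broot T) S) (Ts := fun j => bv_obl T (bcol S j))
       (fun=> erefl) b a) =
  @op_mu _ M (bv_lex T S) (bv_obr (broot T) S) lex_snd
    (fun j => tr (P := M) (isfib_eq (lex_snd_fib j)) (a j)) b.
Proof.
apply: mu_fibs_assoc => [p|j]; first by rewrite /= tagnat.Rank1K.
pose B := bv_obl T (bcol S j).
(* Over [j] the shuffle restricts to the identity in the coordinate [s]; the structure map of an
   identity with unit inputs leaves [a j] unchanged. *)
exists B, B, (fun s => @tagnat.Rank (bar T) (fun=> bar S) s j),
  (@tagnat.Rank (bar S) (fun=> bar T) j), (bq_id B), (@id_units _ M B), (a j).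
split; first exact: lex_snd_fib.
- exact: (@concat_isfib _ (bv_obr (broot T) S) (fun j => bv_obl T (bcol S j)) j erefl).
- move=> p; apply: rank_eq; last by rewrite /= tagnat.Rank1K.
  by apply: val_inj; rewrite /= sig2_Rank.
split.
- by rewrite pk_tr; exact: (f_equal (@pk _ M B) (esym (op_unitl (P := M) (a j)))).
- by rewrite pk_tr.
move=> s; rewrite pk_tr [RHS]pk_tr; apply: (@unit_pk _ M).
exact: (@concat_col _ (bv_obr (broot T) S) (fun j => bv_obl T (bcol S j))).
Qed.
End Shuffle.

(** * The interchange relation *)

(** Stated for families in an arbitrary operad because it serves twice: in [Aop], to construct the
    map out of the tensor product, and in [BV], to verify the relations of [Aop]. *)
Definition interchange (C D : Type) (P : Operad (Bq C)) (Q : Operad (Bq D))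
  (M : Operad (Bq (C * D)))
  (L : forall T : bouquet C, P T -> forall d, M (bv_obl T d))
  (K : forall c (S : bouquet D), Q S -> M (bv_obr c S)) : Prop :=
  forall T S (x : P T) (y : Q S),
  gamma (D := M) (T := bv_obl T (broot S)) (Ts := fun i => bv_obr (bcol T i) S)
    (fun=> erefl) (L T x (broot S)) (fun i => K (bcol T i) S y) =
  sym_act (D := M) (shuffle_bij T S) (@shuffle_col _ _ T S)
    (gamma (D := M) (T := bv_obr (broot T) S)
      (Ts := fun j => bv_obl T (bcol S j)) (fun=> erefl)
      (K (broot T) S y) (fun j => L T x (bcol S j))).

Section Interchange.
Variables (C D : Type) (P : Operad (Bq C)) (Q : Operad (Bq D)).
Variable M : Operad (Bq (C * D)).
Variables (L : forall T, P T -> forall d, M (bv_obl T d)).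
Variables (K : forall c S, Q S -> M (bv_obr c S)).
Hypothesis K_mu : forall c S S' (f : @Hom (Bq D) S S')
  (x : forall i, Q (fib f i)) (y : Q S'),
  K c (op_mu f x y) = @op_mu (Bq (C * D)) M (bv_obr c S) (bv_obr c S') (bq_hom _ f)
    (fun i => K c (x i)) (K c y).
Hypothesis LK : interchange L K.

Section Bracket.
Variables (T : bouquet C) (x : P T) (Sf : 'I_(bar T) -> bouquet D).
Variables (y : forall s, Q (Sf s)) (d : D) (rt : forall s, broot (Sf s) = d).

Definition bracket_ob : bouquet (C * D) :=
  @concat _ (bv_obl T d) (fun s => bv_obr (bcol T s) (Sf s)).

(** The roots of the [Sf s] equal [d] only propositionally, as for objects of a wreath product;
    hence the argument [rt]. *)
Definition bracket : M bracket_ob :=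
  gamma (D := M) (T := bv_obl T d) (Ts := fun s => bv_obr (bcol T s) (Sf s))
    (fun s => f_equal (pair (bcol T s)) (rt s)) (L x d) (fun s => K (bcol T s) (y s)).
End Bracket.

Section Decompose.
Variables (T : bouquet C) (x : P T) (Sf : 'I_(bar T) -> bouquet D) (S : bouquet D).
Variables (w : Q S) (Phi : forall s, bqmap (Sf s) S).
Variable delta : forall s i, Q (bq_fib (Phi s) i).
Arguments delta : clear implicits.

Let src : bouquet (C * D) := bracket_ob Sf (broot S).

Definition bracket_snd : bqmap src (bv_obr (broot T) S) :=
  @Bqmap _ src (bv_obr (broot T) S)
    (fun p => Phi (tagnat.sig1 p) (tagnat.sig2 p)) erefl.

Definition bracket_map : bqmap src (bv_lex T S) :=
  @Bqmap _ src (bv_lex T S)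
    (fun p => @tagnat.Rank (bar T) (fun=> bar S) (tagnat.sig1 p)
       (Phi (tagnat.sig1 p) (tagnat.sig2 p))) erefl.

Lemma bracket_map_Rank s (q : 'I_(bar (Sf s))) :
  bracket_map (@tagnat.Rank _ (fun s => bar (Sf s)) s q) =
  @tagnat.Rank (bar T) (fun=> bar S) s (Phi s q).
Proof.
by rewrite /= /tagnat.sig1 /tagnat.sig2 /tagnat.Rank tagnat.rankK.
Qed.

Lemma bracket_snd_Rank s (q : 'I_(bar (Sf s))) :
  bracket_snd (@tagnat.Rank _ (fun s => bar (Sf s)) s q) = Phi s q.
Proof.
by rewrite /= /tagnat.sig1 /tagnat.sig2 /tagnat.Rank tagnat.rankK.
Qed.

(** [Phi s] carries block [s] into block [s], so each fibre lies in a single block. *)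
Lemma bracket_map_fib s j : isfib bracket_map (@tagnat.Rank (bar T) (fun=> bar S) s j)
  (B := bv_obr (bcol T s) (bq_fib (Phi s) j))
  (fun q => @tagnat.Rank _ (fun s => bar (Sf s)) s (enum_val q)).
Proof.
have Fj := isfib_self (Phi s) j; split=> [p q pq|p|q|].
- by rewrite rank_lt eqxx (isfib_mono Fj) ?orbT.
- split; last first.
    by case=> q <-; rewrite bracket_map_Rank (isfib_map Fj).
  have [s' [q ->]] := rank_cases p; rewrite bracket_map_Rank.
  case/rank_inj2=> es /val_inj ej; subst s'.
  by have /(isfib_img Fj) [q' <-] := ej; exists q'.
- symmetry.
  exact: (@concat_col _ (bv_obl T (broot S)) (fun s => bv_obr (bcol T s) (Sf s)) s).
symmetry.
exact: (@concat_col _ (bv_obl T (broot S)) (fun s => bv_obr (bcol T s) S) s).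
Qed.

Definition bracket_emb j
  (p : 'I_(bar (bracket_ob (fun s => bq_fib (Phi s) j) (bcol S j)))) : 'I_(bar src) :=
  @tagnat.Rank _ (fun s => bar (Sf s)) (tagnat.sig1 p) (enum_val (tagnat.sig2 p)).

Lemma bracket_emb_Rank j s (q : 'I_(bar (bq_fib (Phi s) j))) :
  bracket_emb (@tagnat.Rank _ (fun s => bar (bq_fib (Phi s) j)) s q) =
  @tagnat.Rank _ (fun s => bar (Sf s)) s (enum_val q).
Proof.
by rewrite /bracket_emb /tagnat.sig1 /tagnat.sig2 /tagnat.Rank tagnat.rankK.
Qed.

(** Every block contributes its own fibre of [Phi s] over [j], in lexicographic order, so the fibre
    is again the arity of a bracket. *)
Lemma bracket_snd_fib j : isfib bracket_snd j (@bracket_emb j).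
Proof.
have Fj s := isfib_self (Phi s) j; split=> // [p q|p|p].
- have [s [a ->]] := rank_cases p; have [s' [b ->]] := rank_cases q.
  move=> pq; rewrite !bracket_emb_Rank rank_lt.
  case/orP: (etrans (esym (rank_lt a b)) pq) => [->//|/andP[/eqP es ab]]; subst s'.
  by rewrite eqxx (isfib_mono (Fj s)) ?orbT.
- split; last first.
    case=> q <-; have [s [a ->]] := rank_cases q.
    by rewrite bracket_emb_Rank bracket_snd_Rank (isfib_map (Fj s)).
  have [s [a ->]] := rank_cases p; rewrite bracket_snd_Rank.
  case/(isfib_img (Fj s)) => q <-.
  exists (@tagnat.Rank _ (fun s => bar (bq_fib (Phi s) j)) s q).
  exact: bracket_emb_Rank.
have [s [q ->]] := rank_cases p; rewrite bracket_emb_Rank.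
rewrite [RHS](@concat_col _ (bv_obl T (broot S)) (fun s => bv_obr (bcol T s) (Sf s)) s).
exact: (@concat_col _ (bv_obl T (bcol S j))
  (fun s => bv_obr (bcol T s) (bq_fib (Phi s) j)) s q).
Qed.

(** An index [p] is a [Rank] only up to [sig2K], whence the second transport; [pk_deltas] removes
    both. *)
Let deltas (p : 'I_(bar (bv_lex T S))) : M (bq_fib bracket_map p) :=
  tr (P := M)
    (etrans (isfib_eq (@bracket_map_fib (tagnat.sig1 p) (tagnat.sig2 p)))
            (f_equal (bq_fib bracket_map) (tagnat.sig2K p)))
    (K (bcol T (tagnat.sig1 p)) (delta (tagnat.sig1 p) (tagnat.sig2 p))).

Lemma pk_deltas s j :
  pk (deltas (@tagnat.Rank (bar T) (fun=> bar S) s j)) =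
  pk (K (bcol T s) (delta s j)).
Proof.
by rewrite pk_tr /tagnat.sig1 /tagnat.sig2 /tagnat.Rank tagnat.rankK.
Qed.

(** The equations for the [y s] pull out a bracket all of whose entries are [w], interchange makes
    [w] the outer operation, and associativity collects the [delta s j] with fixed [j] into a
    bracket with [x]. *)
Lemma bracket_mu (y : forall s, Q (Sf s)) (rt : forall s, broot (Sf s) = broot S) :
  (forall s, y s = @op_mu _ Q _ _ (Phi s) (delta s) w) ->
  bracket x y rt =
  @op_mu _ M _ _ bracket_snd
    (fun j => tr (P := M) (isfib_eq (bracket_snd_fib j))
       (bracket x (fun s => delta s j) (fun=> erefl)))
    (K (broot T) w).
Proof.
move=> yE; transitivity (@op_mu _ M _ _ bracket_map deltas
  (bracket x (Sf := fun=> S) (fun=> w) (fun=> erefl))).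
  (* Over the input [s] of [x] lies block [s], where [K_mu] splits [y s] along [Phi s]. *)
  symmetry; apply: mu_fibs_assoc => [p|s]; first by rewrite /= tagnat.Rank1K.
  exists (bv_obr (bcol T s) (Sf s)), (bv_obr (bcol T s) S),
    (@tagnat.Rank _ (fun s => bar (Sf s)) s), (@tagnat.Rank _ (fun=> bar S) s),
    (bq_hom _ (Phi s)), (fun i => K (bcol T s) (delta s i)), (K (bcol T s) w).
  split.
  - apply: (@concat_isfib _ (bv_obl T (broot S)) (fun s => bv_obr (bcol T s) (Sf s)) s).
    by rewrite /= rt.
  - exact: (@concat_isfib _ (bv_obl T (broot S)) (fun s => bv_obr (bcol T s) S) s erefl).
  - by move=> p; exact: esym (bracket_map_Rank p).
  split; [|exact: pk_tr|by move=> j; apply: pk_deltas].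
  by rewrite pk_tr yE K_mu.
(* With all entries equal to [w], the bracket is the left side of interchange; the right side is a
   single structure map along [lex_snd]. *)
rewrite /bracket LK sym_act_shuffle_gamma.
apply: mu_fibs_assoc => [p|j].
  by apply: val_inj; rewrite /= sig2_Rank.
(* Over [j], [bracket_map] restricts to the projection onto the indices [s], along which the
   [delta s j] are plugged into [x]. *)
exists (bracket_ob (fun s => bq_fib (Phi s) j) (bcol S j)), (bv_obl T (bcol S j)),
  (@bracket_emb j), (fun s => @tagnat.Rank (bar T) (fun=> bar S) s j),
  (concat_nu _), (fun s => tr (P := M) (concat_fib (T := bv_obl T (bcol S j))
     (Ts := fun s => bv_obr (bcol T s) (bq_fib (Phi s) j)) (i := s) erefl)
     (K (bcol T s) (delta s j))), (L x (bcol S j)).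
split; [exact: bracket_snd_fib | exact: lex_snd_fib | |].
  move=> p; have [s [q ->]] := rank_cases p.
  rewrite bracket_emb_Rank bracket_map_Rank (isfib_map (isfib_self (Phi s) j)).
  by rewrite /= tagnat.Rank1K.
split; [exact: pk_tr | exact: pk_tr |].
by move=> s; rewrite pk_deltas pk_tr.
Qed.
End Decompose.
End Interchange.

(** * Elements indexed by the wreath product *)

Section WreathBracket.
Variables (C D : Type) (P : Operad (Bq C)) (Q : Operad (Bq D)).
Variable M : Operad (Bq (C * D)).
Variables (L : forall T, P T -> forall d, M (bv_obl T d)).
Variables (K : forall c S, Q S -> M (bv_obr c S)).
Hypothesis L_mu : forall T T' (f : @Hom (Bq C) T T')
  (x : forall i, P (fib f i)) (y : P T') d,
  L (op_mu f x y) d = @op_mu (Bq (C * D)) M (bv_obl T d) (bv_obl T' d) (bq_hom _ f)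
    (fun i => L (x i) d) (L y d).
Hypothesis K_mu : forall c S S' (f : @Hom (Bq D) S S')
  (x : forall i, Q (fib f i)) (y : Q S'),
  K c (op_mu f x y) = @op_mu (Bq (C * D)) M (bv_obr c S) (bv_obr c S') (bq_hom _ f)
    (fun i => K c (x i)) (K c y).
Hypothesis LK : interchange L K.

Lemma bracket_pk T (x : P T) (Sf : 'I_(bar T) -> bouquet D) (y : forall s, Q (Sf s))
  d (rt : forall s, broot (Sf s) = d) d' (rt' : forall s, broot (Sf s) = d') :
  d = d' -> pk (bracket L K x y rt) = pk (bracket L K x y rt').
Proof. by move=> e; subst d'; rewrite (Prop_irrelevance rt rt'). Qed.

Section Restrict.
Variables (T T' : bouquet C) (phi : bqmap T T') (Sf : 'I_(bar T) -> bouquet D).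
Variables (d : D) (t : 'I_(bar T')).

Definition bracket_over : bqmap (bracket_ob Sf d) (bv_obl T' d) :=
  bq_cmp (bq_hom _ phi) (concat_nu (T := bv_obl T d) _).

Let incl (s : 'I_(bar (bq_fib phi t))) : 'I_(bar T) :=
  fin_incl (erefl #|fin_fib phi t|) s.

Definition restrict_emb d'
  (p : 'I_(bar (bracket_ob (T := bq_fib phi t) (fun s => Sf (incl s)) d'))) :
  'I_(bar (bracket_ob Sf d)) :=
  @tagnat.Rank _ (fun s => bar (Sf s)) (incl (tagnat.sig1 p)) (tagnat.sig2 p).

Lemma restrict_emb_Rank d' s (q : 'I_(bar (Sf (incl s)))) :
  @restrict_emb d' (@tagnat.Rank _ (fun s => bar (Sf (incl s))) s q) =
  @tagnat.Rank _ (fun s => bar (Sf s)) (incl s) q.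
Proof.
by rewrite /restrict_emb /tagnat.sig1 /tagnat.sig2 /tagnat.Rank tagnat.rankK.
Qed.

(** [bracket_over] sends all of block [s] to [phi s], so its fibre over [t] consists of the blocks
    with [phi s = t]. The colour [d'] is kept apart from [d] so that it can also be the root of an
    entry of the target, which is only propositionally [d]. *)
Lemma restrict_fib d' : d' = d -> isfib bracket_over t (@restrict_emb d').
Proof.
move=> ed; subst d'; split=> [p q|p|p|//].
- have [s [a ->]] := rank_cases p; have [s' [b ->]] := rank_cases q.
  move=> pq; rewrite !restrict_emb_Rank rank_lt.
  case/orP: (etrans (esym (rank_lt a b)) pq) => [ss|/andP[/eqP es ab]].
    by rewrite fin_incl_mono.
  by subst s'; rewrite eqxx ab orbT.
- split; last first.
    case=> q <-; have [s [a ->]] := rank_cases q.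
    by rewrite restrict_emb_Rank /= tagnat.Rank1K (fin_fibP (erefl _) s).
  have [s [a ->]] := rank_cases p; rewrite /= tagnat.Rank1K => es.
  have sP : s \in fin_fib phi t by rewrite inE; apply/eqP.
  have [s' es'] := fin_incl_surj (erefl #|fin_fib phi t|) sP; subst s.
  by exists (@tagnat.Rank _ (fun s => bar (Sf (incl s))) s' a); rewrite restrict_emb_Rank.
have [s [q ->]] := rank_cases p; rewrite restrict_emb_Rank.
rewrite [RHS](@concat_col _ (bv_obl T d) (fun s => bv_obr (bcol T s) (Sf s)) (incl s)).
rewrite [LHS](@concat_col _ (bv_obl (bq_fib phi t) d)
  (fun s => bv_obr (bcol (bq_fib phi t) s) (Sf (incl s))) s).
by congr (pair (bcol T _) _); rewrite /incl fin_incl_id.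
Qed.
End Restrict.

(** Well typed without transport: the arity of [W] in the wreath product unfolds to the
    lexicographic sum [bracket_ob]. *)
Definition wr_bracket (W : wr_ob (Groth P) (Groth Q)) : M (Ar (O := wreath _ _) W) :=
  bracket L K (T := projT1 (wX W)) (projT2 (wX W)) (Sf := fun s => projT1 (@wY _ _ W s))
    (fun s => projT2 (@wY _ _ W s)) (@wdP _ _ W).

Lemma wr_bracketE W : pk (wr_bracket W) =
  pk (bracket L K (T := projT1 (wX W)) (projT2 (wX W)) (Sf := fun s => projT1 (@wY _ _ W s))
    (fun s => projT2 (@wY _ _ W s)) (@wdP _ _ W)).
Proof. by []. Qed.

Lemma wr_bracket_pk W V : W = V -> pk (wr_bracket W) = pk (wr_bracket V).
Proof. by move=> ->. Qed.

Lemma wr_bracket_fib (W V : wr_ob (Groth P) (Groth Q)) (F : wr_hom W V) t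
  (j : 'I_(bar (projT1 (@wY _ _ V t)))) :
  pk (wr_bracket (wr_fib F (@wr_pair _ _ V t j))) =
  pk (bracket L K (T := bq_fib (g_map (wphi F)) t) (g_eps (wphi F) t)
       (fun s => g_eps (wPhi (fin_fibP (fib_card (wphi F) t) s)) j) (fun=> erefl)).
Proof.
apply: etrans (wr_bracket_pk (wr_fib_pair F j)) _.
apply: etrans (wr_bracketE (wr_fib2 F j)) _.
exact: (@bracket_pk (bq_fib (g_map (wphi F)) t) (g_eps (wphi F) t) _
  (fun s => g_eps (wPhi (fin_fibP (fib_card (wphi F) t) s)) j) _ _ _ _ erefl).
Qed.

(** Both sides equal one structure map along [bracket_over], which groups the inputs by their image
    [t] under [phi]: the left side by [bracket_mu] for each [Z t], the right side by [L_mu] along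
    [phi]. *)
Lemma wr_bracket_hom (W V : wr_ob (Groth P) (Groth Q)) (F : wr_hom W V) :
  @op_mu _ M _ _ (Ar_hom (O := wreath _ _) F)
    (fun q => tr (P := M) (Ar_fib (O := wreath _ _) F q) (wr_bracket (wr_fib F q)))
    (wr_bracket V) = wr_bracket W.
Proof.
case: W V F => [[T x] Y d p] [[T' z] Z d' p'] F.
have /= ed := wd_eq F; subst d'.
pose phi : bqmap T T' := g_map (wphi F).
pose Sf (s : 'I_(bar T)) := projT1 (Y s).
pose inc t : 'I_(bar (bq_fib phi t)) -> 'I_(bar T) :=
  fin_incl (erefl #|fin_fib phi t|).
pose w t := tr (P := M) (isfib_eq (@restrict_fib T T' phi Sf d t d erefl))
  (bracket L K (T := bq_fib phi t) (g_eps (wphi F) t)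
     (fun s => projT2 (Y (inc t s))) (fun=> p _)).
transitivity (@op_mu _ M _ _ (bracket_over phi Sf d) w (L z d)).
  apply: mu_fibs_assoc => [q|t].
    have [s [a ->]] := rank_cases q.
    have E := @wr_cmap_pair _ _ _ _ F s a _ erefl.
    apply: etrans (f_equal phi (tagnat.Rank1K a)) _.
    apply: etrans (f_equal (fun r => tagnat.sig1 r) (esym E)).
    exact: esym (tagnat.Rank1K _).
  pose Phi s : bqmap (Sf (inc t s)) (projT1 (Z t)) :=
    g_map (wPhi (fin_fibP (fib_card (wphi F) t) s)).
  pose delta s i : Q (bq_fib (Phi s) i) :=
    g_eps (wPhi (fin_fibP (fib_card (wphi F) t) s)) i.
  pose x' j := tr (P := M)
    (isfib_eq (@bracket_snd_fib C D (bq_fib phi t) _ (projT1 (Z t)) Phi j))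
    (bracket L K (T := bq_fib phi t) (g_eps (wphi F) t)
       (fun s => delta s j) (fun=> erefl)).
  exists (bracket_ob (T := bq_fib phi t)
      (fun s => Sf (inc t s)) (broot (projT1 (Z t)))),
    (bv_obr (bcol T' t) (projT1 (Z t))),
    (@restrict_emb T T' phi Sf d t (broot (projT1 (Z t)))),
    (@tagnat.Rank _ (fun s => bar (projT1 (Z s))) t),
    (@bracket_snd C D (bq_fib phi t) _ (projT1 (Z t)) Phi), x',
    (K (bcol T' t) (projT2 (Z t))).
  split.
  - exact: restrict_fib (p' t).
  - exact: (@concat_isfib _ (bv_obl T' d)
      (fun s => bv_obr (bcol T' s) (projT1 (Z s))) t
      (f_equal (pair (bcol T' t)) (p' t))).
  - move=> q; have [s [a ->]] := rank_cases q.
    rewrite bracket_snd_Rank restrict_emb_Rank.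
    exact: esym (@wr_cmap_pair _ _ _ _ F (inc t s) a _
      (fin_fibP (fib_card (wphi F) t) s)).
  split; [|exact: pk_tr|]; last first.
  - move=> j; rewrite pk_tr [RHS]pk_tr.
    exact: wr_bracket_fib.
  rewrite pk_tr.
  (* [bracket_mu] needs the roots expressed through the target [Z t] instead of [d]. *)
  have rt s : broot (Sf (inc t s)) = broot (projT1 (Z t)).
    exact: bqmap_root (Phi s).
  have E := @bracket_pk (bq_fib phi t) (g_eps (wphi F) t) _
    (fun s => projT2 (Y (inc t s))) d (fun s => p _) _ rt
    (esym (p' t)).
  apply: etrans E _.
  congr (pk _); apply: bracket_mu => // s.
  (* The hypothesis of [bracket_mu] is the equation carried by a morphism of the Grothendieck
     construction, here the component of [F] at [s]. *)
  exact: esym (g_mu (wPhi (fin_fibP (fib_card (wphi F) t) s))).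
symmetry; rewrite /wr_bracket /bracket /gamma /=.
(* The equation carried by [wphi F] decomposes [x] along [phi]; the bracket of [W] becomes an
   iterated structure map that can be regrouped over [T']. *)
have LE : L x d = @op_mu _ M (bv_obl T d) (bv_obl T' d) (bq_hom _ phi)
    (fun i => L (g_eps (wphi F) i) d) (L z d).
  by rewrite -L_mu; congr (L _ d); exact: esym (g_mu (wphi F)).
rewrite LE; apply: mu_fibs_assoc => [q //|t].
exists (bracket_ob (T := bq_fib phi t)
      (fun s => Sf (inc t s)) d),
  (bv_obl (bq_fib phi t) d), (@restrict_emb T T' phi Sf d t d),
  (@enum_val _ (mem (fin_fib phi t))), (concat_nu _),
  (fun s => tr (P := M) (concat_fib (T := bv_obl (bq_fib phi t) d)
     (Ts := fun s => bv_obr (bcol (bq_fib phi t) s) (Sf (inc t s))) (i := s)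
     (f_equal (pair _) (p _)))
     (K (bcol (bq_fib phi t) s) (projT2 (Y (inc t s))))),
  (L (g_eps (wphi F) t) d).
split.
- exact: restrict_fib erefl.
- exact: (isfib_self (bq_hom (fun c => (c, d)) phi) t).
- move=> q; have [s [a ->]] := rank_cases q.
  rewrite restrict_emb_Rank /= !tagnat.Rank1K /inc fin_incl_id; reflexivity.
split; [exact: pk_tr | by [] |].
by move=> s; rewrite !pk_tr /inc fin_incl_id.
Qed.
End WreathBracket.

(** * Operads presented by objects of an operadic category *)

Section SOpIso.
Variables (C : Type) (X Y : Operad (Bq C)).

(** The carriers of [pull id Y] and [Y] are convertible, but their structure maps agree only
    propositionally. *)
Lemma pull_id_mu (f : OpHom X Y) T S (h : @Hom (Bq C) T S)
  (x : forall i, X (fib h i)) (y : X S) :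
  op_fun f (op_mu h x y) =
  @op_mu (Bq C) (pull id Y) T S h (fun i => op_fun f (x i)) (op_fun f y).
Proof. by rewrite op_fun_mu -(@sop_id_mu {| sop := Y |}). Qed.

Definition sop_lift (f : OpHom X Y) : SOpHom {| sop := X |} {| sop := Y |} := {|
  scol := id : scolours {| sop := X |} -> scolours {| sop := Y |};
  smor := @Build_OpHom _ X (pull id Y) (fun T => op_fun f (T := T)) (op_fun_unit f)
            (@pull_id_mu f) |}.
End SOpIso.

Lemma sop_iso_lift (C : Type) (X Y : Operad (Bq C)) (f : OpHom X Y) (g : OpHom Y X) :
  (forall T (x : X T), op_fun g (op_fun f x) = x) ->
  (forall T (y : Y T), op_fun f (op_fun g y) = y) ->
  sop_iso {| sop := X |} {| sop := Y |}.
Proof.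
move=> gf fg; exists (sop_lift f), (sop_lift g); split.
  by congr Build_SOpHom; apply: op_hom_eq => T x; apply: gf.
by congr Build_SOpHom; apply: op_hom_eq => T x; apply: fg.
Qed.

Lemma op_fun_tr (O : OpCat) (P Q : Operad O) (f : OpHom P Q) T S (e : T = S) (x : P T) :
  op_fun f (tr (P := P) e x) = tr (P := Q) e (op_fun f x).
Proof. by case: _ / e. Qed.

Section Classes.
Variable O : OpCat.

Definition ob_class (W : Ob O) : Aop O (Ar W) := pres_class (@A_rel O) (A_class W).

Lemma ob_class_unit c : pk (ob_class (U c)) = pk (op_unit (Aop O) c).
Proof.
rewrite -(pk_tr (Ar_U c) (op_unit (Aop O) c)); congr pk.
rewrite /ob_class (pres_class_rel (A_rel_unit c)).
exact: pres_class_tr.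
Qed.

(** Makes the relation attached to [F] usable at arities such as [bv_obl T d], which equal those of
    objects only propositionally; hence the comparison of maps on underlying numbers and of elements
    through [pk]. *)
Lemma ob_class_mu W V (F : Hom W V) A B (f : bqmap A B)
  (x : forall i, Aop O (bq_fib f i)) (y : Aop O B) :
  A = Ar W -> B = Ar V ->
  (forall (p : 'I_(bar A)) (p' : 'I_(Defs.card W)), p = p' :> nat ->
     f p = cmap F p' :> nat) ->
  (forall (i : 'I_(bar B)) (i' : 'I_(Defs.card V)), i = i' :> nat ->
     pk (x i) = pk (ob_class (fib F i'))) ->
  pk y = pk (ob_class V) ->
  pk (@op_mu _ (Aop O) _ _ f x y) = pk (ob_class W).
Proof.
move=> eA eB fF xF yV.
rewrite [in RHS]/ob_class -(pres_class_rel (A_rel_mu F)) pres_class_mu.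
apply: (@mu_congr (Bq (pi0 O)) (Aop O) _ _ _ _ f (Ar_hom F)) => //.
  exact: (bqarr_eq eA eB).
by move=> i i' ii'; rewrite (xF _ _ ii') pres_class_tr pk_tr.
Qed.

Section Lift.
Variables (N : Operad (Bq (pi0 O))) (phi : forall W : Ob O, N (Ar W)).
Hypothesis phi_unit : forall c, phi (U c) = tr (P := N) (Ar_U c) (op_unit N c).
Hypothesis phi_mu : forall W V (F : Hom W V),
  @op_mu _ N _ _ (Ar_hom F)
    (fun i => tr (P := N) (Ar_fib F i) (phi (fib F i))) (phi V) = phi W.

Definition A_gen_map T (g : A_gen (O := O) T) : N T :=
  match g with A_ob W => phi W end.

Lemma A_gen_map_rel T (a b : @A_term O T) : A_rel a b ->
  @eval (Bq (pi0 O)) (@A_gen O) N A_gen_map T a =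
  @eval (Bq (pi0 O)) (@A_gen O) N A_gen_map T b.
Proof.
case=> [c|W V F]; first by rewrite eval_tr; exact: phi_unit.
rewrite /= -[RHS](phi_mu F); congr op_mu.
by apply: functional_extensionality_dep => i; rewrite eval_tr.
Qed.

Definition A_lift : OpHom (Aop O) N := pres_lift A_gen_map_rel.

Lemma A_liftE W : op_fun A_lift (ob_class W) = phi W.
Proof. exact: (pres_liftE A_gen_map_rel). Qed.
End Lift.
End Classes.

(** * The Boardman-Vogt tensor product *)

Section DataMap.
Variables (C : Type) (D D' : OpData (Bq C)) (h : forall T, D T -> D' T).
Arguments h {T} _.
Hypothesis h_unit : forall c, h (op_unit D c) = op_unit D' c.
Hypothesis h_mu : forall T S (f : @Hom (Bq C) T S) (x : forall i, D (fib f i)) (y : D S),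
  h (op_mu f x y) = op_mu f (fun i => h (x i)) (h y).

Lemma map_tr T S (e : T = S) (x : D T) :
  h (tr (P := D) e x) = tr (P := D') e (h x).
Proof. by case: _ / e. Qed.

(** Formulated for bare operad data because the source will be the data of terms, before the laws
    are imposed. *)
Lemma map_gamma T (Ts : 'I_(bar T) -> bouquet C)
  (e : forall i, broot (Ts i) = bcol T i) (x : D T) (xs : forall i, D (Ts i)) :
  h (gamma e x xs) = gamma e (h x) (fun i => h (xs i)).
Proof.
rewrite h_mu; congr op_mu.
by apply: functional_extensionality_dep => i; rewrite map_tr.
Qed.

Lemma map_sym_act T S (p : bqmap T S) (pb : bijective p)
  (pc : forall x, bcol S (p x) = bcol T x) (x : D S) :
  h (sym_act pb pc x) = sym_act pb pc (h x).
Proof.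
rewrite h_mu; congr op_mu.
by apply: functional_extensionality_dep => i; rewrite map_tr h_unit.
Qed.
End DataMap.

Section BVClasses.
Variables (C D : Type) (P : Operad (Bq C)) (Q : Operad (Bq D)).
Let M : Operad (Bq (C * D)) := BV P Q.

Definition bv_cl T (x : P T) d : M (bv_obl T d) :=
  pres_class (@bv_rel _ _ P Q) (bv_l Q x d).
Definition bv_cr c S (y : Q S) : M (bv_obr c S) :=
  pres_class (@bv_rel _ _ P Q) (bv_r P c y).

Lemma bv_cl_unit c d : bv_cl (op_unit P c) d = op_unit M (c, d).
Proof. exact: pres_class_rel (bv_rel_unitl P Q c d). Qed.

Lemma bv_cr_unit c d : bv_cr c (op_unit Q d) = op_unit M (c, d).
Proof. exact: pres_class_rel (bv_rel_unitr P Q c d). Qed.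

Lemma bv_cl_mu T T' (f : @Hom (Bq C) T T') (x : forall i, P (fib f i)) (y : P T') d :
  bv_cl (op_mu f x y) d = @op_mu (Bq (C * D)) M (bv_obl T d) (bv_obl T' d) (bq_hom _ f)
    (fun i => bv_cl (x i) d) (bv_cl y d).
Proof. by rewrite /bv_cl (pres_class_rel (bv_rel_mul Q x y d)) pres_class_mu. Qed.

Lemma bv_cr_mu c S S' (f : @Hom (Bq D) S S') (x : forall i, Q (fib f i)) (y : Q S') :
  bv_cr c (op_mu f x y) = @op_mu (Bq (C * D)) M (bv_obr c S) (bv_obr c S') (bq_hom _ f)
    (fun i => bv_cr c (x i)) (bv_cr c y).
Proof. by rewrite /bv_cr (pres_class_rel (bv_rel_mur P c x y)) pres_class_mu. Qed.

Lemma bv_cl_cr : interchange (M := M) (@bv_cl) (@bv_cr).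
Proof.
move=> T S x y.
pose h T := @pres_class _ _ (@bv_rel _ _ P Q) T.
have hm := @pres_class_mu _ _ (@bv_rel _ _ P Q).
rewrite -(map_gamma (D := bv_data P Q) (h := h) hm).
rewrite -[in RHS](map_gamma (D := bv_data P Q) (h := h) hm).
rewrite -(map_sym_act (D := bv_data P Q) (h := h) _ hm) //.
exact: pres_class_rel (bv_rel_interchange x y).
Qed.

Section Lift.
Variable N : Operad (Bq (C * D)).
Variables (L : forall T, P T -> forall d, N (bv_obl T d)).
Variables (K : forall c S, Q S -> N (bv_obr c S)).
Hypothesis L_unit : forall c d, L (op_unit P c) d = op_unit N (c, d).
Hypothesis K_unit : forall c d, K c (op_unit Q d) = op_unit N (c, d).
Hypothesis L_mu : forall T T' (f : @Hom (Bq C) T T')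
  (x : forall i, P (fib f i)) (y : P T') d,
  L (op_mu f x y) d = @op_mu (Bq (C * D)) N (bv_obl T d) (bv_obl T' d) (bq_hom _ f)
    (fun i => L (x i) d) (L y d).
Hypothesis K_mu : forall c S S' (f : @Hom (Bq D) S S')
  (x : forall i, Q (fib f i)) (y : Q S'),
  K c (op_mu f x y) = @op_mu (Bq (C * D)) N (bv_obr c S) (bv_obr c S') (bq_hom _ f)
    (fun i => K c (x i)) (K c y).
Hypothesis LK : interchange L K.

Definition bv_gen_map T (g : bv_gen P Q T) : N T :=
  match g with bv_genl _ x d => L x d | bv_genr c _ y => K c y end.

Let ev T := @eval (Bq (C * D)) (bv_gen P Q) N bv_gen_map T.

Lemma bv_gen_map_rel T (a b : @bv_term C D P Q T) : bv_rel a b -> ev a = ev b.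
Proof.
case=> [c d|S S' f x y d|c d|c S S' f x y|S S' x y].
- exact: L_unit.
- exact: L_mu.
- exact: K_unit.
- exact: K_mu.
rewrite (map_sym_act (D := bv_data P Q) (h := ev)) //.
by rewrite !(map_gamma (D := bv_data P Q) (h := ev)) //; exact: LK.
Qed.

Definition bv_lift : OpHom M N := pres_lift bv_gen_map_rel.

Lemma bv_lift_l T (x : P T) d : op_fun bv_lift (bv_cl x d) = L x d.
Proof. exact: (pres_liftE bv_gen_map_rel). Qed.

Lemma bv_lift_r c S (y : Q S) : op_fun bv_lift (bv_cr c y) = K c y.
Proof. exact: (pres_liftE bv_gen_map_rel). Qed.
End Lift.
End BVClasses.

(** * The comparison *)

(** Used for the objects (x; u, ..., u): with singleton blocks, position and block index
    coincide. *)
Lemma rank_ones n (p_ : 'I_n -> nat) i (x : 'I_(p_ i)) :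
  (forall i, p_ i = 1) -> @tagnat.Rank n p_ i x = i :> nat.
Proof.
move=> p1; rewrite tagnat.RankEsum (eq_bigr (fun=> 1)) => [|k _]; last exact: p1.
have -> : x = 0 :> nat by move: (x); rewrite p1 => y; rewrite ord1.
by rewrite addn0 (big_ord_narrow (ltnW (ltn_ord i))) sum1_card card_ord.
Qed.

Lemma rank_single n (p_ : 'I_n -> nat) i (x : 'I_(p_ i)) : n = 1 ->
  @tagnat.Rank n p_ i x = x :> nat.
Proof.
move=> n1; subst n; rewrite tagnat.RankEsum big_pred0 // => k.
by rewrite (ord1 i).
Qed.

Section Comparison.
Variables (C D : Type) (P : Operad (Bq C)) (Q : Operad (Bq D)).
Let O : OpCat := wreath (Groth P) (Groth Q).
Let N : Operad (Bq (C * D)) := Aop O.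

Definition wr_l T (x : P T) (d : D) : wr_ob (Groth P) (Groth Q) :=
  @WrOb (Groth P) (Groth Q) (existT P T x) (fun=> g_U Q d) d (fun=> erefl).

Definition wr_r (c : C) S (y : Q S) : wr_ob (Groth P) (Groth Q) :=
  @WrOb (Groth P) (Groth Q) (g_U P c) (fun=> existT Q S y) (broot S) (fun=> erefl).

Definition wr_lr T S (x : P T) (y : Q S) : wr_ob (Groth P) (Groth Q) :=
  @WrOb (Groth P) (Groth Q) (existT P T x) (fun=> existT Q S y) (broot S) (fun=> erefl).

Lemma Ar_wr_l T (x : P T) d : Ar (O := O) (wr_l x d) = bv_obl T d.
Proof.
apply: bouquet_eq => [||p q pq] //=.
  by rewrite /wr_card /= sum1_card card_ord.
have [i [a ep]] := rank_cases p; congr pair; congr (bcol T); apply: val_inj.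
by apply: etrans pq; rewrite ep /wr_fst tagnat.Rank1K; symmetry; exact: rank_ones.
Qed.

Lemma Ar_wr_r c S (y : Q S) : Ar (O := O) (wr_r c y) = bv_obr c S.
Proof.
apply: bouquet_eq => [||p q pq] //=.
  by rewrite /wr_card /= big_ord1.
have [i [a ep]] := rank_cases p; congr pair; congr (bcol S); apply: val_inj.
apply: etrans pq; rewrite ep; apply: etrans (sig2_Rank _) _.
by symmetry; exact: rank_single.
Qed.

Definition A_l T (x : P T) d : N (bv_obl T d) :=
  tr (P := N) (Ar_wr_l x d) (ob_class (O := O) (wr_l x d)).
Definition A_r c S (y : Q S) : N (bv_obr c S) :=
  tr (P := N) (Ar_wr_r c y) (ob_class (O := O) (wr_r c y)).

Lemma ob_class_pk (V W : wr_ob (Groth P) (Groth Q)) : V = W ->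
  pk (ob_class (O := O) V) = pk (ob_class (O := O) W).
Proof. by move=> ->. Qed.

(** Indexing by lexicographic pairs turns the fibres of [F] into [wr_fib2], which can be compared
    componentwise. *)
Lemma wr_class_mu (W V : wr_ob (Groth P) (Groth Q)) (F : wr_hom W V) A B
  (f : bqmap A B) (x : forall i, N (bq_fib f i)) (y : N B) :
  A = Ar (O := O) W -> B = Ar (O := O) V ->
  (forall s a (p : 'I_(bar A)), p = @wr_pair _ _ W s a :> nat ->
     f p = wr_pair (cmap (wPhi (erefl (cmap (wphi F) s))) a) :> nat) ->
  (forall t j (i : 'I_(bar B)), i = @wr_pair _ _ V t j :> nat ->
     pk (x i) = pk (ob_class (O := O) (wr_fib2 F j))) ->
  pk y = pk (ob_class (O := O) V) ->
  pk (@op_mu _ N _ _ f x y) = pk (ob_class (O := O) W).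
Proof.
move=> eA eB fF xF yV; apply: (@ob_class_mu O W V F) => // [p p' pp'|i i' ii'].
  have [s [a e]] := wr_pairP p'.
  rewrite (fF s a) ?pp' ?e //; congr nat_of_ord; symmetry; exact: wr_cmap_pair.
have [t [j e]] := wr_pairP i'.
by rewrite (xF t j) ?ii' ?e //; apply: ob_class_pk; symmetry; exact: wr_fib_pair.
Qed.

Lemma A_l_unit c d : A_l (op_unit P c) d = op_unit N (c, d).
Proof.
apply: (@pk_inj _ N); rewrite pk_tr -[RHS](ob_class_unit (O := O) (c, d)).
by apply: ob_class_pk; apply: wr_ob_eq.
Qed.

Lemma A_r_unit c d : A_r c (op_unit Q d) = op_unit N (c, d).
Proof.
apply: (@pk_inj _ N); rewrite pk_tr -[RHS](ob_class_unit (O := O) (c, d)).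
by apply: ob_class_pk; apply: wr_ob_eq.
Qed.

Lemma A_l_mu T T' (f : @Hom (Bq C) T T') (x : forall i, P (fib f i)) (y : P T') d :
  A_l (op_mu f x y) d = @op_mu (Bq (C * D)) N (bv_obl T d) (bv_obl T' d) (bq_hom _ f)
    (fun i => A_l (x i) d) (A_l y d).
Proof.
apply: (@pk_inj _ N); rewrite pk_tr; symmetry.
(* With identities in the second coordinate, the fibre of [F] over the input [t] is (x_t; u, ...,
   u), since identities have unit fibres. *)
pose F := @WrHom (Groth P) (Groth Q) (wr_l (op_mu f x y) d) (wr_l y d)
  (@GHom _ P (existT P T (op_mu f x y)) (existT P T' y) f x erefl)
  (fun _ _ _ => idm (o := Groth Q) (g_U Q d)) erefl.
apply: (wr_class_mu (F := F));
  [exact: esym (Ar_wr_l _ _) | exact: esym (Ar_wr_l _ _) | | | exact: pk_tr].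
  move=> s a p pE; rewrite [RHS]rank_ones //; congr (nat_of_ord (bfun f _)).
  by apply: val_inj; rewrite /= pE [LHS]rank_ones.
move=> t j i iE; rewrite pk_tr; have -> : i = t.
  by apply: val_inj; rewrite /= iE [LHS]rank_ones.
apply: ob_class_pk; apply: wr_ob_eq => // s s' ss'.
exact: esym (fib_id_U (O := Groth Q) j).
Qed.

Lemma A_r_mu c S S' (f : @Hom (Bq D) S S') (x : forall i, Q (fib f i)) (y : Q S') :
  A_r c (op_mu f x y) = @op_mu (Bq (C * D)) N (bv_obr c S) (bv_obr c S') (bq_hom _ f)
    (fun i => A_r c (x i)) (A_r c y).
Proof.
apply: (@pk_inj _ N); rewrite pk_tr; symmetry.
pose F := @WrHom (Groth P) (Groth Q) (wr_r c (op_mu f x y)) (wr_r c y)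
  (idm (o := Groth P) (g_U P c))
  (fun _ _ _ => @GHom _ Q (existT Q S (op_mu f x y)) (existT Q S' y) f x erefl)
  (bqmap_root f).
apply: (wr_class_mu (F := F));
  [exact: esym (Ar_wr_r _ _) | exact: esym (Ar_wr_r _ _) | | | exact: pk_tr].
  move=> s a p pE; rewrite [RHS]rank_single //; congr (nat_of_ord (bfun f _)).
  by apply: val_inj; rewrite /= pE [LHS]rank_single.
move=> t j i iE; rewrite pk_tr; have -> : i = j.
  by apply: val_inj; rewrite /= iE [LHS]rank_single.
apply: ob_class_pk; apply: wr_ob_eq => //.
exact: esym (fib_id_U (O := Groth P) t).
Qed.

(* The object [(x; y, ..., y)] decomposes in two ways, through [(x; u, ..., u)]
   and through [(u; y)]. *)
Lemma A_interchange : interchange (M := N) (@A_l) (@A_r).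
Proof.
move=> T S x y.
rewrite sym_act_shuffle_gamma; apply: (@pk_inj _ N).
transitivity (pk (ob_class (O := O) (wr_lr x y))); last symmetry.
  (* Keeping [x] and collapsing every copy of [y] to a unit gives the fibres (u; y). *)
  pose F := @WrHom (Groth P) (Groth Q) (wr_lr x y) (wr_l x (broot S))
    (idm (o := Groth P) (existT P T x))
    (fun _ _ _ => bang (O := Groth Q) (T := existT Q S y) erefl) erefl.
  apply: (wr_class_mu (F := F)); [by [] | exact: esym (Ar_wr_l _ _) | | | exact: pk_tr].
    move=> s a p pE; rewrite [RHS]rank_ones //.
    by rewrite (val_inj pE : p = @tagnat.Rank (bar T) (fun=> bar S) s a) /= tagnat.Rank1K.
  move=> t j i iE; rewrite !pk_tr; have -> : i = t.
    by apply: val_inj; rewrite /= iE [LHS]rank_ones.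
  apply: ob_class_pk; apply: wr_ob_eq => //=.
  - exact: esym (fib_id_U (O := Groth P) t).
  - move=> s s' _; exact: esym (AX3a_ob (o := Groth Q) _ j).
(* Collapsing [x] and keeping [y] gives the fibres (x; u, ..., u). *)
pose F := @WrHom (Groth P) (Groth Q) (wr_lr x y) (wr_r (broot T) y)
  (bang (O := Groth P) (T := existT P T x) erefl)
  (fun _ _ _ => idm (o := Groth Q) (existT Q S y)) erefl.
apply: (wr_class_mu (F := F)); [by [] | exact: esym (Ar_wr_r _ _) | | | exact: pk_tr].
  move=> s a p pE; rewrite [RHS]rank_single //.
  by rewrite (val_inj pE : p = @tagnat.Rank (bar T) (fun=> bar S) s a) /= sig2_Rank.
move=> t j i iE; rewrite !pk_tr; have -> : i = j.
  by apply: val_inj; rewrite /= iE [LHS]rank_single.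
apply: ob_class_pk; apply: wr_ob_eq => //=.
- exact: esym (AX3a_ob (o := Groth P) _ t).
- move=> s s' _; exact: esym (fib_id_U (O := Groth Q) j).
Qed.

Let M : Operad (Bq (C * D)) := BV P Q.

Definition bv_bracket (W : Ob O) : M (Ar (O := O) W) :=
  wr_bracket (@bv_cl C D P Q) (@bv_cr C D P Q) W.

Lemma bv_bracket_unit c :
  bv_bracket (U c) = tr (P := M) (Ar_U (O := O) c) (op_unit M c).
Proof.
case: c => c d; apply: (pk_unitr (P := M) (c := (c, d))).
  by rewrite -bv_cl_unit.
move=> i; rewrite !pk_tr -bv_cr_unit; reflexivity.
Qed.

Lemma bv_bracket_mu (W V : Ob O) (F : Hom W V) :
  @op_mu _ M _ _ (Ar_hom (O := O) F)
    (fun i => tr (P := M) (Ar_fib (O := O) F i) (bv_bracket (fib F i)))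
    (bv_bracket V) = bv_bracket W.
Proof.
exact: (wr_bracket_hom (@bv_cl_mu C D P Q) (@bv_cr_mu C D P Q) (@bv_cl_cr C D P Q)).
Qed.

Definition bv_to_A : OpHom M N :=
  bv_lift A_l_unit A_r_unit A_l_mu A_r_mu A_interchange.

Definition A_to_bv : OpHom N M := A_lift bv_bracket_unit bv_bracket_mu.

(** The entries of the bracket are units, so this is the unit law for identities, once [Ar_wr_l] and
    [rank_ones] identify the sum of unary arities with [bv_obl T d]. *)
Lemma bv_bracket_l T (x : P T) d : pk (bv_bracket (wr_l x d)) = pk (bv_cl Q x d).
Proof.
apply: etrans _ (f_equal (@pk _ M (bv_obl T d)) (op_unitl (P := M) (bv_cl Q x d))).
rewrite /bv_bracket /wr_bracket /bracket /gamma.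
apply: (@mu_congr (Bq (C * D)) M _ _ _ _
  (concat_nu (T := bv_obl T d) (fun s => bv_obr (bcol T s) (bq_U d)))
  (bq_id (bv_obl T d))) => //.
  apply: bqarr_eq => // [|p p' pp']; first exact: Ar_wr_l.
  have [s [a ep]] := rank_cases p; apply: etrans pp'; rewrite ep.
  by apply: etrans (f_equal val (tagnat.Rank1K a)) _; symmetry; exact: rank_ones.
move=> i i' /val_inj <-; rewrite pk_tr [RHS]pk_tr bv_cr_unit.
reflexivity.
Qed.

Lemma bv_bracket_r c S (y : Q S) : pk (bv_bracket (wr_r c y)) = pk (bv_cr P c y).
Proof.
rewrite -(pk_tr (esym (Ar_wr_r c y)) (bv_cr P c y)); congr pk.
apply: (pk_unitr (P := M) (c := (c, broot S))).
  by rewrite -bv_cl_unit.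
by move=> i; rewrite !pk_tr.
Qed.

Lemma A_to_bvK T (q : N T) : op_fun bv_to_A (op_fun A_to_bv q) = q.
Proof.
apply: (@pres_ext _ _ _ T (fun T q => op_fun bv_to_A (op_fun A_to_bv q))).
- by move=> c; rewrite !op_fun_unit.
- by move=> R S f x y; rewrite !op_fun_mu.
move=> _ [W]; rewrite [op_fun A_to_bv _](A_liftE bv_bracket_unit bv_bracket_mu W).
case: W => [[R x] Y d p].
pose W : wr_ob (Groth P) (Groth Q) := WrOb p.
(* This morphism keeps [x] and collapses each entry of [Y] to a unit. Its fibres are (u; y_s), so
   its relation reassembles the class of [W] from the images of the factors of the bracket. *)
pose F := @WrHom (Groth P) (Groth Q) W (wr_l x d) (idm (o := Groth P) (existT P R x))
  (fun i _ _ => bang (p i)) erefl.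
apply: etrans (op_fun_mu bv_to_A _ _) _; apply: (@pk_inj _ N).
apply: (wr_class_mu (F := F)); [by [] | exact: esym (Ar_wr_l _ _) | | |].
- move=> s a z zE; rewrite [RHS]rank_ones //.
  rewrite (val_inj zE : z = @tagnat.Rank (bar R) (fun s => bar (projT1 (Y s))) s a).
  by rewrite /= tagnat.Rank1K.
- move=> t j i iE; have -> : i = t.
    by apply: val_inj; rewrite /= iE [LHS]rank_ones.
  rewrite op_fun_tr pk_tr [op_fun bv_to_A _]bv_lift_r pk_tr.
  apply: ob_class_pk; apply: wr_ob_eq => /=.
  + exact: esym (fib_id_U (O := Groth P) t).
  + move=> s s' _; apply: etrans (esym (AX3a_ob (o := Groth Q) _ j)).
    (* Only the index [t] lies over [t] under the identity, so the fibre in question is [Y t]. *)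
    have -> := wr_id_eq (W := W) (fin_fibP (fib_card (wphi F) t) s').
    by case: (Y t).
  + exact: p.
- by rewrite [op_fun bv_to_A _]bv_lift_l; exact: pk_tr.
Qed.

Lemma bv_to_AK T (q : M T) : op_fun A_to_bv (op_fun bv_to_A q) = q.
Proof.
apply: (@pres_ext _ _ _ T (fun T q => op_fun A_to_bv (op_fun bv_to_A q))).
- by move=> c; rewrite !op_fun_unit.
- by move=> R S f x y; rewrite !op_fun_mu.
move=> _ [R x d|c S y].
- rewrite -[LHS]/(op_fun A_to_bv (op_fun bv_to_A (bv_cl Q x d))) bv_lift_l /A_l op_fun_tr
    (A_liftE bv_bracket_unit bv_bracket_mu).
  apply: tr_pk; exact: bv_bracket_l.
- rewrite -[LHS]/(op_fun A_to_bv (op_fun bv_to_A (bv_cr P c y))) bv_lift_r /A_r op_fun_tr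
    (A_liftE bv_bracket_unit bv_bracket_mu).
  apply: tr_pk; exact: bv_bracket_r.
Qed.
End Comparison.

Theorem corollary26 (C D : Type) (P : Operad (Bq C)) (Q : Operad (Bq D)) :
  sop_iso (BV P Q) (Aop (wreath (Groth P) (Groth Q))).
Proof. exact: sop_iso_lift (@bv_to_AK C D P Q) (@A_to_bvK C D P Q). Qed.
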